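(* Let $\omega\in\mathbb C$ be a primitive cube root of unity, let $r$ be a root of $r^3=1-\omega$, and let $E:=\mathbb Q(r)$. Let $\Gamma=\langle a,b\mid (ba)^3,(ab^{-1}a)^3,[ba,ab^{-1}a]\rangle$ and let $\Gamma^\circ$ be the kernel of the homomorphism $\mu\colon\Gamma\to C_3=\langle\sigma\mid\sigma^3=1\rangle$ with $\mu(a)=\sigma$, $\mu(b)=\sigma^2$. Then the assignment $$\pi(a)=\begin{pmatrix}\omega r^2 & \frac{-2\omega-1}{3}r^2 & \frac{-\omega-2}{3}r^2\\ -r^2 & -\omega r^2 & \frac{-2\omega-1}{3}r^2\\ -(\omega+1)r^2 & r^2 & r^2\end{pmatrix},\qquad \pi(b)=\begin{pmatrix}0&0&\frac{\omega+2}{3}r\\ r&0&(\omega+1)r\\ 0&r&\omega r\end{pmatrix}$$ extends to a representation $\pi\colon\Gamma\to\mathrm{PSL}_3(E)$. The image of $\pi$ is commensurable with $K_0=\mathrm{PSL}_3(\mathbb Z[\omega])$, hence arithmetic. More precisely: (1) $\pi(\Gamma)\cap K_0=\pi(\Gamma^\circ)$ has index $3$ in $\pi(\Gamma)$; (2) $\pi(\Gamma)\cap K_0$ has index $2^4\cdot 3\cdot 13=624$ in $K_0$, and moreover (a) $K_2\subseteq\pi(\Gamma)$; (b) under the identification $K_1/K_2=\mathfrak{sl}_3(\mathbb F_3)$, $$(\pi(\Gamma)\cap K_1)/K_2=\left\{\begin{pmatrix}0&a&b\\ c&d&e\\ 0&f&-d\end{pmatrix}\ \middle|\ a,b,c,d,e,f\in\mathbb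 F_3\right\}\subseteq\mathfrak{sl}_3(\mathbb F_3);$$ (c) under the identification $K_0/K_1=\mathrm{PSL}_3(\mathbb F_3)$, one has $(\pi(\Gamma)\cap K_0)/(\pi(\Gamma)\cap K_1)=\mathrm U_+(\mathbb F_3)\subseteq\mathrm{PSL}_3(\mathbb F_3)$.
   Context: Notation: $[x,y]$ denotes the commutator $xyx^{-1}y^{-1}$. The displayed matrices are taken modulo scalars. For an ideal $I$ of $\mathbb Z[\omega]$, $\mathrm{PSL}_3(\mathbb Z[\omega];I)$ denotes the congruence subgroup of $\mathrm{PSL}_3(\mathbb Z[\omega])$ associated with $I$, i.e. the image in $\mathrm{PSL}_3(\mathbb Z[\omega])$ of the kernel of $\mathrm{SL}_3(\mathbb Z[\omega])\to\mathrm{SL}_3(\mathbb Z[\omega]/I)$. Put $K_n:=\mathrm{PSL}_3(\mathbb Z[\omega];((1-\omega)^n))$ for $n=0,1,2$, so $K_0=\mathrm{PSL}_3(\mathbb Z[\omega])$. Since $\omega=1-r^3\in E$, these are regarded as subgroups of $\mathrm{PSL}_3(E)$. The ring $\mathbb Z[\omega]/((1-\omega))$ is canonically identified with $\mathbb F_3$. With this, $K_0/K_1$ is identified with $\mathrm{PSL}_3(\mathbb F_3)$ (reduction modulo $1-\omega$), and $K_1/K_2$ is identified with $\mathfrak{sl}_3(\mathbb F_3)$, the space of trace-zero $3\times 3$ matrices over $\mathbb F_3$ (an element represented by $I_3+(1-\omega)X$ corresponding to $X$ modulo $1-\omega$). $\mathrm U_+(\mathbb F_3)\subseteq\mathrm{PSL}_3(\mathbb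 F_3)$ is the subgroup of upper triangular unipotent matrices. Two subgroups are commensurable if their intersection has finite index in both.
   Formalization: In (b), K_1/K_2 is sl_3(F_3) modulo scalar matrices (order 3^7, since ωI is trivial in PSL_3), not sl_3(F_3) itself; (b) is stated as: (π(Γ)∩K_1)/K_2 is the image of the displayed set under X ↦ [I+(1−ω)X]. *)

(* Defs.v *)
From HB Require Import structures.
From mathcomp Require Import all_boot all_order all_algebra.
From mathcomp Require Import all_classical reals.
From mathcomp.real_closed Require Import complex.

Set Implicit Arguments.
Unset Strict Implicit.
Unset Printing Implicit Defensive.

Import GRing.Theory.
Local Open Scope ring_scope.
Local Open Scope classical_set_scope.
Local Open Scope quotient_scope.

Section Presentation.
Variable X : choiceType.

(* (x, true) is the letter x and (x, false) the letter x^-1. *)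
Definition word : Type := seq (X * bool).

Definition winv (u : word) : word := rev [seq (l.1, ~~ l.2) | l <- u].
Definition wexp (u : word) (n : nat) : word := flatten (nseq n u).
(* The convention is [u, v] = u v u^-1 v^-1, unlike MathComp's [~ u, v]. *)
Definition wcomm (u v : word) : word := u ++ v ++ winv u ++ winv v.

Inductive pres_eq (rels : seq word) : word -> word -> Prop :=
| PresRefl u : pres_eq rels u u
| PresSym u v : pres_eq rels u v -> pres_eq rels v u
| PresTrans u v w : pres_eq rels u v -> pres_eq rels v w -> pres_eq rels u w
| PresCat u u' v v' :
    pres_eq rels u u' -> pres_eq rels v v' -> pres_eq rels (u ++ v) (u' ++ v')
| PresCancel x e : pres_eq rels [:: (x, e); (x, ~~ e)] [::]
| PresRel u : u \in rels -> pres_eq rels u [::].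

Definition pres_eqb rels : rel (seq (X * bool)) := fun u v => `[< pres_eq rels u v >].

Lemma pres_eqb_equiv rels : equiv_class_of (pres_eqb rels).
Proof.
split=> [u|u v|v u w].
- exact/asboolP/PresRefl.
- by apply/asboolP/asboolP => /PresSym.
- by move=> /asboolP uv /asboolP vw; apply/asboolP/(PresTrans uv vw).
Qed.

Canonical pres_equiv rels := EquivRelPack (pres_eqb_equiv rels).

Definition presented (rels : seq word) := {eq_quot (pres_equiv rels)}.

HB.instance Definition _ rels := Choice.on (presented rels).
HB.instance Definition _ rels := Quotient.on (presented rels).

Section Group.
Variable rels : seq word.
Local Notation G := (presented rels).

Definition pres_of (u : word) : G := \pi_G u.

Lemma pres_ofP u v : pres_of u = pres_of v <-> pres_eq rels u v.
Proof.
split=> [/eqmodP /asboolP //|h]; exact/eqmodP/asboolP.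
Qed.

Lemma pres_winvK u : winv (winv u) = u.
Proof.
rewrite /winv map_rev revK -map_comp -[RHS]map_id.
by apply: eq_map => -[x e] /=; rewrite negbK.
Qed.

Lemma pres_catV u : pres_eq rels (u ++ winv u) [::].
Proof.
elim: u => [|[x e] u IHu]; first exact: PresRefl.
rewrite /winv /= rev_cons -cats1 catA -/(winv u).
rewrite -[_ :: _]/([:: (x, e)] ++ (u ++ winv u) ++ [:: (x, ~~ e)]).
apply: PresTrans (PresCancel _ x e).
apply: (@PresCat _ [:: _] [:: _]); first exact: PresRefl.
apply: (@PresCat _ _ [::]) => //; exact: PresRefl.
Qed.

Lemma pres_eq_winv u v : pres_eq rels u v -> pres_eq rels (winv u) (winv v).
Proof.
move=> uv.
have h1 : pres_eq rels (winv u) ((winv u ++ v) ++ winv v).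
  rewrite -catA -{1}[winv u]cats0; apply: PresCat (PresRefl _ _) _.
  exact/PresSym/pres_catV.
have h2 : pres_eq rels (winv u ++ v) [::].
  apply: PresTrans (_ : pres_eq rels (winv u ++ winv (winv u)) _).
    by rewrite pres_winvK; apply: PresCat (PresRefl _ _) (PresSym uv).
  exact: pres_catV.
by apply: PresTrans h1 _; apply: (@PresCat _ _ [::]) => //; apply: PresRefl.
Qed.

Definition pres_mul (g h : G) : G := pres_of (repr g ++ repr h).
Definition pres_inv (g : G) : G := pres_of (winv (repr g)).

Lemma pres_repr u : pres_eq rels (repr (pres_of u)) u.
Proof. by apply/pres_ofP; rewrite /pres_of reprK. Qed.

Lemma pres_mulE u v : pres_mul (pres_of u) (pres_of v) = pres_of (u ++ v).
Proof. by apply/pres_ofP; apply: PresCat; apply: pres_repr. Qed.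

Lemma pres_invE u : pres_inv (pres_of u) = pres_of (winv u).
Proof. by apply/pres_ofP; apply: pres_eq_winv; apply: pres_repr. Qed.

Lemma pres_ofK (g : G) : exists u, g = pres_of u.
Proof. by exists (repr g); rewrite /pres_of reprK. Qed.

Fact pres_mulA : associative pres_mul.
Proof.
move=> g h k; have [[[u ->] [v ->]] [w ->]] := (pres_ofK g, pres_ofK h, pres_ofK k).
by rewrite !pres_mulE catA.
Qed.
Fact pres_mul1 : left_id (pres_of [::]) pres_mul.
Proof. by move=> g; have [u ->] := pres_ofK g; rewrite pres_mulE. Qed.
Fact pres_mulr1 : right_id (pres_of [::]) pres_mul.
Proof. by move=> g; have [u ->] := pres_ofK g; rewrite pres_mulE cats0. Qed.
Fact pres_mulV : right_inverse (pres_of [::]) pres_inv pres_mul.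
Proof.
move=> g; have [u ->] := pres_ofK g; rewrite pres_invE pres_mulE.
exact/pres_ofP/pres_catV.
Qed.
Fact pres_mulVl : left_inverse (pres_of [::]) pres_inv pres_mul.
Proof.
move=> g; have [u ->] := pres_ofK g; rewrite pres_invE pres_mulE.
by apply/pres_ofP; rewrite -{2}[u]pres_winvK; apply: pres_catV.
Qed.

HB.instance Definition _ :=
  isGroup.Build G pres_mulA pres_mul1 pres_mulr1 pres_mulVl pres_mulV.

Lemma pres_ofM u v : pres_of (u ++ v) = (pres_of u * pres_of v)%g.
Proof. by rewrite -pres_mulE. Qed.

Section Lift.
Variables (H : groupType) (f : X -> H).

Definition weval (u : word) : H :=
  (\prod_(l <- u) (if l.2 then f l.1 else (f l.1)^-1))%g.

Lemma weval_cat u v : weval (u ++ v) = (weval u * weval v)%g.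
Proof. exact: big_cat. Qed.

Hypothesis f_rels : forall u, u \in rels -> weval u = 1%g.

Lemma weval_pres u v : pres_eq rels u v -> weval u = weval v.
Proof.
elim=> {u v} [//|u v _ -> //|u v w _ -> _ -> //|u u' v v' _ e1 _ e2|x e|u /f_rels ->].
- by rewrite !weval_cat e1 e2.
- by rewrite /weval !big_cons !big_nil mulg1; case: e; rewrite ?mulgV ?mulVg.
- by rewrite /weval big_nil.
Qed.

Definition pres_lift of (forall u, u \in rels -> weval u = 1%g) :=
  fun g : G => weval (repr g).
Local Notation lift := (pres_lift f_rels).

Lemma pres_liftE u : lift (pres_of u) = weval u.
Proof. exact/weval_pres/pres_repr. Qed.

Fact pres_liftM : {morph lift : g h / (g * h)%g}.
Proof.
move=> g h; have [[u ->] [v ->]] := (pres_ofK g, pres_ofK h).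
by rewrite -pres_ofM !pres_liftE weval_cat.
Qed.

HB.instance Definition _ := isMultiplicative.Build G H lift pres_liftM.

End Lift.
End Group.
End Presentation.

Section Gamma.

Definition word_a : word bool := [:: (true, true)].
Definition word_b : word bool := [:: (false, true)].

Definition Gamma_rels : seq (word bool) :=
  let ba := word_b ++ word_a in
  let abVa := word_a ++ winv word_b ++ word_a in
  [:: wexp ba 3; wexp abVa 3; wcomm ba abVa].

Definition Gamma := presented Gamma_rels.
HB.instance Definition _ := Group.on Gamma.

Definition gen_a : Gamma := pres_of Gamma_rels word_a.
Definition gen_b : Gamma := pres_of Gamma_rels word_b.

(* C_3 is the additive group of 'Z_3, written multiplicatively. *)
Definition sigma : 'Z_3 := Zp1.

Definition mu_gen (x : bool) : 'Z_3 := if x then sigma else (sigma ^+ 2)%g.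

Lemma mu_rels u : u \in Gamma_rels -> weval mu_gen u = 1%g.
Proof.
rewrite !inE => /or3P[] /eqP->; rewrite /weval !big_cons big_nil /=;
  by apply/val_inj; vm_compute.
Qed.

Definition mu : {multiplicative Gamma -> 'Z_3} := pres_lift mu_rels.

Lemma mu_a : mu gen_a = sigma.
Proof. by rewrite /mu /gen_a /= pres_liftE /weval big_seq1. Qed.

Lemma mu_b : mu gen_b = (sigma ^+ 2)%g.
Proof. by rewrite /mu /gen_b /= pres_liftE /weval big_seq1. Qed.

Definition Gamma0 : set Gamma := [set g | mu g = 1%g].

End Gamma.

Section PSL.
Variables (n : nat) (F : fieldType).

Record SL := MkSL { SLval :> 'M[F]_n; _ : \det SLval == 1 }.
HB.instance Definition _ := [isSub for SLval].
HB.instance Definition _ := [Choice of SL by <:].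

Lemma det_SL (A : SL) : \det A = 1.
Proof. by case: A => A /= /eqP. Qed.

Lemma SL_unit (A : SL) : SLval A \in unitmx.
Proof. by rewrite unitmxE det_SL unitr1. Qed.

Fact SL_one_subproof : \det (1%:M : 'M[F]_n) == 1.
Proof. by rewrite det1. Qed.
Fact SL_mul_subproof (A B : SL) : \det (A *m B) == 1.
Proof. by rewrite det_mulmx !det_SL mulr1. Qed.
Fact SL_inv_subproof (A : SL) : \det (invmx A) == 1.
Proof. by rewrite det_inv det_SL invr1. Qed.

Definition SL_one := MkSL SL_one_subproof.
Definition SL_mul A B := MkSL (SL_mul_subproof A B).
Definition SL_inv A := MkSL (SL_inv_subproof A).

Fact SL_mulA : associative SL_mul.
Proof. by move=> A B C; apply/val_inj; rewrite /= mulmxA. Qed.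
Fact SL_mul1 : left_id SL_one SL_mul.
Proof. by move=> A; apply/val_inj; rewrite /= mul1mx. Qed.
Fact SL_mulr1 : right_id SL_one SL_mul.
Proof. by move=> A; apply/val_inj; rewrite /= mulmx1. Qed.
Fact SL_mulVl : left_inverse SL_one SL_inv SL_mul.
Proof. by move=> A; apply/val_inj; rewrite /= mulVmx ?SL_unit. Qed.
Fact SL_mulV : right_inverse SL_one SL_inv SL_mul.
Proof. by move=> A; apply/val_inj; rewrite /= mulmxV ?SL_unit. Qed.

HB.instance Definition _ :=
  isGroup.Build SL SL_mulA SL_mul1 SL_mulr1 SL_mulVl SL_mulV.

Definition scal_eq : rel SL := fun A B => is_scalar_mx (invmx A *m B).

Lemma scal_eqP (A B : SL) : reflect (exists c, SLval B = c *: SLval A) (scal_eq A B).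
Proof.
apply: (iffP is_scalar_mxP) => -[c h]; exists c.
  by rewrite -mul_mx_scalar -h mulKVmx ?SL_unit.
by rewrite h -scalemxAr mulVmx ?SL_unit // scalemx1.
Qed.

Lemma scal_eq_equiv : equiv_class_of scal_eq.
Proof.
have sym A B : scal_eq A B -> scal_eq B A.
  move=> /scal_eqP[c h]; apply/scal_eqP.
  have [c0|c0] := eqVneq c 0; last by exists c^-1; rewrite h scalerA mulVf ?scale1r.
  exists 1; rewrite scale1r; apply/matrixP => i.
  have n_gt0 : n != 0%N by case: (n) i => [[]|].
  have := det_SL B; rewrite h c0 detZ det_SL mulr1 expr0n (negPf n_gt0).
  by move/esym/eqP; rewrite oner_eq0.
split=> [A|A B|B A C].
- by apply/scal_eqP; exists 1; rewrite scale1r.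
- by apply/idP/idP; apply: sym.
- move=> /scal_eqP[c h] /scal_eqP[d k]; apply/scal_eqP; exists (d * c).
  by rewrite k h scalerA.
Qed.

Canonical scal_equiv := EquivRelPack scal_eq_equiv.

Definition PSL := {eq_quot scal_equiv}.
HB.instance Definition _ := Choice.on PSL.
HB.instance Definition _ := Quotient.on PSL.

Definition PSL_of (A : SL) : PSL := \pi_PSL A.

Lemma PSL_ofP (A B : SL) : PSL_of A = PSL_of B <-> exists c, SLval B = c *: SLval A.
Proof.
split=> [/eqmodP /scal_eqP //|h]; exact/eqmodP/scal_eqP.
Qed.

Definition PSL_mul (g h : PSL) : PSL := PSL_of (repr g * repr h)%g.
Definition PSL_inv (g : PSL) : PSL := PSL_of (repr g)^-1%g.

Lemma PSL_repr A : exists c, SLval A = c *: SLval (repr (PSL_of A)).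
Proof. by apply/PSL_ofP; rewrite /PSL_of reprK. Qed.

Lemma PSL_mulE A B : PSL_mul (PSL_of A) (PSL_of B) = PSL_of (A * B)%g.
Proof.
have [[c hc] [d hd]] := (PSL_repr A, PSL_repr B).
apply/PSL_ofP; exists (d * c); rewrite /= hc hd.
by rewrite -scalemxAl -scalemxAr scalerA mulrC.
Qed.

Lemma PSL_invE A : PSL_inv (PSL_of A) = PSL_of A^-1%g.
Proof.
have [c hc] := PSL_repr A.
apply/esym/PSL_ofP; exists c => /=.
have/(congr1 (mulmx^~ (invmx (repr (PSL_of A) : SL)))) := hc.
rewrite -scalemxAl mulmxV ?SL_unit // => h.
by rewrite -[LHS](mulKmx (SL_unit A)) h -scalemxAr mulmx1.
Qed.

Lemma PSL_ofK (g : PSL) : exists A, g = PSL_of A.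
Proof. by exists (repr g); rewrite /PSL_of reprK. Qed.

Fact PSL_mulA : associative PSL_mul.
Proof.
move=> g h k; have [[[u ->] [v ->]] [w ->]] := (PSL_ofK g, PSL_ofK h, PSL_ofK k).
by rewrite !PSL_mulE mulgA.
Qed.
Fact PSL_mul1 : left_id (PSL_of 1%g) PSL_mul.
Proof. by move=> g; have [u ->] := PSL_ofK g; rewrite PSL_mulE mul1g. Qed.
Fact PSL_mulr1 : right_id (PSL_of 1%g) PSL_mul.
Proof. by move=> g; have [u ->] := PSL_ofK g; rewrite PSL_mulE mulg1. Qed.
Fact PSL_mulVl : left_inverse (PSL_of 1%g) PSL_inv PSL_mul.
Proof. by move=> g; have [u ->] := PSL_ofK g; rewrite PSL_invE PSL_mulE mulVg. Qed.
Fact PSL_mulV : right_inverse (PSL_of 1%g) PSL_inv PSL_mul.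
Proof. by move=> g; have [u ->] := PSL_ofK g; rewrite PSL_invE PSL_mulE mulgV. Qed.

HB.instance Definition _ :=
  isGroup.Build PSL PSL_mulA PSL_mul1 PSL_mulr1 PSL_mulVl PSL_mulV.

Lemma PSL_ofM (A B : SL) : PSL_of (A * B)%g = (PSL_of A * PSL_of B)%g.
Proof. by rewrite -PSL_mulE. Qed.

(* In particular A must have determinant 1. *)
Definition represents (A : 'M[F]_n) (g : PSL) : Prop :=
  exists2 S : SL, SLval S = A & PSL_of S = g.

(* Image in PSL_n(F) of the kernel of SL_n(O) -> SL_n(O / I), for a subring O
   of F and an ideal I of O. *)
Definition PSL_cong (O I : set F) : set PSL :=
  [set g | exists A : 'M[F]_n,
    [/\ represents A g, forall i j, O (A i j)
      & forall i j, I (A i j - (i == j)%:R)]].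

End PSL.

Section Subgroups.
Variable G : groupType.
Implicit Types H K : set G.

Definition lcoset (g : G) H : set G := [set (g * h)%g | h in H].

(* For subgroups K and H, the set K/H when H is contained in K; in general it is
   KH/H, so that for K, H contained in L with H normal in L it is the subgroup
   K/(K `&` H) of L/H. *)
Definition lcosets K H : set (set G) := [set lcoset g H | g in K].

Definition has_index K H (m : nat) : Prop := (lcosets K H #= `I_m)%card.

Definition commensurable H K : Prop :=
  finite_set (lcosets H (H `&` K)) /\ finite_set (lcosets K (H `&` K)).

End Subgroups.

Section Fields.
Variable F : fieldType.

(* The smallest subfield of F containing r; it is Q(r) in characteristic zero. *)
Definition in_Qadj (r : F) : {pred F} :=
  fun x => `[< forall S : {pred F}, divring_closed S -> r \in S -> x \in S >].

Fact in_Qadj_closed r : divring_closed (in_Qadj r).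
Proof.
split=> [|x y xS yS|x y xS yS]; apply/asboolP => S hS rS;
  case: (hS) => S1 SB SD; first exact: S1.
- by move: xS yS => /asboolP xS /asboolP yS; apply: SB; [apply: xS|apply: yS].
- by move: xS yS => /asboolP xS /asboolP yS; apply: SD; [apply: xS|apply: yS].
Qed.
HB.instance Definition _ r :=
  GRing.isDivringClosed.Build F (in_Qadj r) (in_Qadj_closed r).

Lemma in_Qadj_gen r : r \in in_Qadj r.
Proof. exact/asboolP. Qed.

Record Qadj (r : F) := MkQadj { Qadj_val :> F; _ : Qadj_val \in in_Qadj r }.
HB.instance Definition _ r := [isSub for @Qadj_val r].
HB.instance Definition _ r := [Choice of Qadj r by <:].
HB.instance Definition _ r := [SubChoice_isSubIntegralDomain of Qadj r by <:].
HB.instance Definition _ r := [SubIntegralDomain_isSubField of Qadj r by <:].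

Definition Qadj_gen (r : F) : Qadj r := MkQadj (in_Qadj_gen r).

Lemma omega_in_Qadj (omega r : F) : r ^+ 3 = 1 - omega -> omega \in in_Qadj r.
Proof.
move=> h; have -> : omega = 1 - r ^+ 3 by rewrite h subKr.
by rewrite rpredB ?rpred1 // rpredX // in_Qadj_gen.
Qed.

Definition Zadj (w : F) : set F := [set x | exists p : {poly int}, x = (map_poly intr p).[w]].

Definition principal (O : set F) (x : F) : set F := [set x * y | y in O].

Definition number_field (k : {pred F}) : Prop :=
  divring_closed k /\
  exists2 e : seq F, {subset e <= k} &
    forall x, x \in k -> exists c : nat -> rat, x = \sum_(i < size e) ratr (c i) * e`_i.

Definition ring_of_integers (k : {pred F}) : set F :=
  [set x | x \in k /\ integralOver (intr : int -> F) x].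

(* Arithmeticity with respect to the group PSL_n over a number field in F. *)
Definition arithmetic (n : nat) (H : set (PSL n F)) : Prop :=
  exists2 k : {pred F}, number_field k &
    let O := ring_of_integers k in commensurable H (PSL_cong O O).

End Fields.

Section Matrices.
Variable F : fieldType.

Definition mx3 (T : nzRingType) (l : seq (seq T)) : 'M[T]_3 :=
  \matrix_(i, j) (nth [::] l i)`_j.

Variables w r : F.

Definition pi_a : 'M[F]_3 := mx3 [::
  [:: w * r ^+ 2; (- 2 * w - 1) / 3 * r ^+ 2; (- w - 2) / 3 * r ^+ 2];
  [:: - r ^+ 2; - w * r ^+ 2; (- 2 * w - 1) / 3 * r ^+ 2];
  [:: - (w + 1) * r ^+ 2; r ^+ 2; r ^+ 2]].

Definition pi_b : 'M[F]_3 := mx3 [::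
  [:: 0; 0; (w + 2) / 3 * r];
  [:: r; 0; (w + 1) * r];
  [:: 0; r; w * r]].

Definition K (n : nat) : set (PSL 3 F) :=
  PSL_cong (Zadj w) (principal (Zadj w) ((1 - w) ^+ n)).

(* x lies in Z[w] and its class modulo 1 - w is c, for Z[w]/(1 - w) = F_3. *)
Definition reduces (x : F) (c : 'F_3) : Prop :=
  principal (Zadj w) (1 - w) (x - (c : nat)%:R).

Definition reduces_mx (A : 'M[F]_3) (B : 'M['F_3]_3) : Prop :=
  forall i j, reduces (A i j) (B i j).

(* The element of K_0/K_1 identified with x in PSL_3(F_3). *)
Definition coset01 (x : PSL 3 'F_3) : set (PSL 3 F) :=
  [set g | exists A B, [/\ represents A g, reduces_mx A B & represents B x]].

(* The element of K_1/K_2 represented by I + (1 - w) Y for any Y over Z[w]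
   lifting X.  Since w I = I + (1 - w) (- I) is trivial in PSL_3, coset12 X
   depends only on X modulo the scalar matrices. *)
Definition coset12 (X : 'M['F_3]_3) : set (PSL 3 F) :=
  [set g | exists2 Y, reduces_mx Y X & represents (1%:M + (1 - w) *: Y) g].

End Matrices.

Definition Uplus : set (PSL 3 'F_3) :=
  [set x | exists2 A, represents A x &
    forall i j : 'I_3, (j <= i)%N -> A i j = (i == j)%:R].

Definition sl3_sub : set 'M['F_3]_3 :=
  [set X | exists a b c d e f : 'F_3, X = mx3 [::
    [:: 0; a; b];
    [:: c; d; e];
    [:: 0; f; - d]]].

(* Main.v *)
(* Write O = Z[w] and p = (1 - w), so that O/p = F_3.  The kernel of mu is generated by a^3 and by
   the conjugates of b a under 1, a and a^2, which act by matrices of SL_3(O).  Let H be the group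
   of the matrices of SL_3(O) that are upper unitriangular modulo p and satisfy
   x_12 + x_23 + x_31 / (1 - w) = 0 modulo p; it contains these four matrices and the scalar w, and
   the point is that they generate it.

   Let Gen be the group they generate.  Explicit words show that Gen contains the elementary
   matrices of H and is normalized by E_12(1); hence I = <E_12(1)> Gen is a group that contains all
   the elementary matrices which are upper unitriangular modulo p.  The union of the cells U(O) s I,
   with s running over the signed permutation matrices, is stable under left multiplication by
   elementary matrices (a rank one computation, as for a BN-pair), so it is SL_3(O) because O is
   Euclidean.  An element of H can only lie in the cell s = 1, so it lies in I, and then the linear
   condition puts it in Gen.

   The assertions of the theorem thus become statements on H.  It has index 3 in I, and I is the
   stabilizer of one of the 208 = 26 * 8 pairs over F_3 of a nonzero vector and a nonzero linear
   form that vanishes on it, whence the index 624.  The image of a is not in PSL_3(O) because r^2 is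
   not in O: the cube of its norm would be 9. *)
Require Import Defs.
From HB Require Import structures.
From Stdlib Require Import ZArith Ring Lia.
From mathcomp Require Import all_boot.

Set Implicit Arguments.
Unset Strict Implicit.
Unset Printing Implicit Defensive.

(** * Eisenstein integers *)

(** Knowing the images of [Gen] in all congruence quotients would not suffice: a subgroup of
    infinite index may surject onto each of them. Hence the explicit words, which supply whole root
    subgroups over O and leave the rest to Euclid's algorithm.

    Divided by 1 - w, the linear condition is a homomorphism from I to F_3 that takes the value 1 on
    each of E12(1), E23(1) and E31(1 - w), the elements of the three simple affine roots. It is the
    only thing that separates [Gen] from I, and any one of the three elements generates I over
    [Gen].

    The scalar w is a generator so that [Gen] is a full preimage: two matrices over O of the same
    class in PSL_3 differ by a power of w, so membership does not depend on the representative.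
    Words and finite lists are evaluated over pairs of integers; the root r enters only through
    matrix identities that involve a and b. *)

Section Eisenstein.
Local Open Scope Z_scope.

(* [Eis a b] stands for [a + b w], where [w] is a primitive cube root of unity. *)
Record eis := Eis { ere : Z; eim : Z }.

Definition eadd x y := Eis (ere x + ere y) (eim x + eim y).
Definition eopp x := Eis (- ere x) (- eim x).
Definition esub x y := Eis (ere x - ere y) (eim x - eim y).
Definition emul x y :=
  Eis (ere x * ere y - eim x * eim y)
      (ere x * eim y + eim x * ere y - eim x * eim y).
Definition eeqb x y := (ere x =? ere y) && (eim x =? eim y).
Definition e0 := Eis 0 0.
Definition e1 := Eis 1 0.
Definition ew := Eis 0 1.
Definition epi := Eis 1 (-1).
Definition enorm x := ere x * ere x - ere x * eim x + eim x * eim x.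

Lemma eis_ring_theory : ring_theory e0 e1 eadd emul esub eopp eq.
Proof.
split=> *; rewrite /eadd /emul /esub /eopp /e0 /e1;
  repeat match goal with x : eis |- _ => destruct x end; cbn [ere eim];
  apply: f_equal2; ring.
Qed.

Lemma eeqbP x y : eeqb x y = true -> x = y.
Proof. by case: x y => [a b] [c d] /andP[/Z.eqb_eq /= -> /Z.eqb_eq /= ->]. Qed.

End Eisenstein.

Declare Scope eis_scope.
Delimit Scope eis_scope with eis.
Bind Scope eis_scope with eis.
Notation "x + y" := (eadd x y) : eis_scope.
Notation "x * y" := (emul x y) : eis_scope.
Notation "x - y" := (esub x y) : eis_scope.
Notation "- x" := (eopp x) : eis_scope.
Notation "0" := e0 : eis_scope.
Notation "1" := e1 : eis_scope.

Ltac eis_cst t :=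
  match t with
  | e0 => constr:(e0) | e1 => constr:(e1)
  | ew => constr:(ew) | epi => constr:(epi)
  | Eis ?a ?b =>
      let a' := isZcst a in let b' := isZcst b in
      match constr:((a', b')) with (true, true) => t | _ => constr:(InitialRing.NotConstant) end
  | _ => constr:(InitialRing.NotConstant)
  end.
Add Ring eis_ring : eis_ring_theory (decidable eeqbP, constants [eis_cst]).

Section Euclid.
Local Open Scope eis_scope.

Lemma enormM x y : enorm (x * y) = (enorm x * enorm y)%Z.
Proof. by rewrite /enorm /=; ring. Qed.

Lemma enorm_ge0 x : (0 <= enorm x)%Z.
Proof. rewrite /enorm; nia. Qed.
Arguments enorm_ge0 : clear implicits.

Lemma enorm_eq0 x : enorm x = 0%Z -> x = 0.
Proof. case: x => a b; rewrite /enorm /= => h; apply: f_equal2; nia. Qed.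

Lemma enormN x : enorm (- x) = enorm x.
Proof. by rewrite /enorm /=; ring. Qed.

Definition econj x := Eis (ere x - eim x) (- eim x).

Lemma emul_conj x : x * econj x = Eis (enorm x) 0.
Proof. by rewrite /econj /enorm /emul; cbn [ere eim]; apply: f_equal2; ring. Qed.

Lemma eis_mul_eq0 x y : x * y = 0 -> x = 0 \/ y = 0.
Proof.
move=> h; have := f_equal enorm h; rewrite enormM (_ : enorm 0 = 0%Z) //.
by case/Z.mul_eq_0 => /enorm_eq0; [left|right].
Qed.

Lemma Z_round a n : (0 < n)%Z -> exists q, (Z.abs (2 * (a - n * q)) <= n)%Z.
Proof.
(* The nearest integer to a / n is the floor of a / n + 1 / 2. *)
move=> n0; exists ((2 * a + n) / (2 * n))%Z.
have := Z.mod_pos_bound (2 * a + n) (2 * n) ltac:(lia).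
have := Z.div_mod (2 * a + n) (2 * n) ltac:(lia).
lia.
Qed.

(* The quotient of [x] by [y] is obtained by rounding both coordinates of [x * conj y / N y]. *)
Lemma eis_euclid x y : y <> 0 -> exists q, (enorm (x - q * y) < enorm y)%Z.
Proof.
move=> y0; have n0 : (0 < enorm y)%Z.
  have : enorm y <> 0%Z by move=> /enorm_eq0.
  by have := enorm_ge0 y; lia.
pose cy := econj y.
have [q1 h1] := Z_round (ere (x * cy)) n0.
have [q2 h2] := Z_round (eim (x * cy)) n0.
exists (Eis q1 q2).
(* Multiplying by the norm of [y], which is also that of its conjugate, clears the denominator: N(y)
   N(x - q y) = N(x conj(y) - N(y) q). *)
suff : (enorm y * enorm (x - Eis q1 q2 * y) < enorm y * enorm y)%Z by nia.
have e : (enorm y * enorm (x - Eis q1 q2 * y))%Z =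
    enorm (Eis (ere (x * cy) - enorm y * q1) (eim (x * cy) - enorm y * q2)).
  by rewrite /enorm /cy /econj /=; ring.
rewrite e /enorm; cbn [ere eim].
move: h1 h2 n0; set n := (ere y * _ - _ + _)%Z; rewrite -/(enorm y).
change n with (enorm y).
set u := (ere _ - _)%Z; set v := (eim _ - _)%Z => h1 h2 n0.
(* Both coordinates are at most N / 2 in absolute value, so u^2 - u v + v^2 is at most 3 N^2 / 4. *)
have : (4 * (u * u) <= enorm y * enorm y)%Z by nia.
have : (4 * (v * v) <= enorm y * enorm y)%Z by nia.
nia.
Qed.

(* Row operations [f] and [g] run Euclid's algorithm on the pair [(x A, y A)]. *)
Lemma eis_euclid_ind (T : Type) (f g : eis -> T -> T) (x y : T -> eis) (I R : T -> Prop) :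
  (forall t A, x (f t A) = x A + t * y A) -> (forall t A, y (f t A) = y A) ->
  (forall t A, y (g t A) = y A + t * x A) -> (forall t A, x (g t A) = x A) ->
  (forall t A, I A -> I (f t A)) -> (forall t A, I A -> I (g t A)) ->
  (forall t A, R (f t A) -> R A) -> (forall t A, R (g t A) -> R A) ->
  (forall A, I A -> y A = 0 -> R A) -> forall A, I A -> R A.
Proof.
move=> xf yf yg xg If Ig Rf Rg base A.
have [n] : exists n : nat, (enorm (y A) <= Z.of_nat n)%Z.
  by exists (Z.to_nat (enorm (y A))); have := enorm_ge0 (y A); lia.
elim: n A => [|n IH] A hn IA.
  by apply: base => //; apply: enorm_eq0; have := enorm_ge0 (y A); lia.
have [y0|y0] := Z.eq_dec (enorm (y A)) 0; first by apply: base => //; apply: enorm_eq0.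
have [q hq] : exists q, (enorm (x A - q * y A) < enorm (y A))%Z.
  by apply: eis_euclid => e; apply: y0; rewrite e.
(* After the division step (x, y) becomes (x - q y, y); the other three operations make up a signed
   swap, which leads to (y, - (x - q y)). *)
apply: (Rf (- q)); apply: (Rf 1); apply: (Rg (- (1))); apply: (Rf 1).
apply: IH; last exact: (If _ _ (Ig _ _ (If _ _ (If _ _ IA)))).
rewrite !(yf, yg, xf, xg).
have -> : y A + - (1) * (x A + - q * y A + 1 * y A) = - (x A - q * y A) by ring.
by rewrite enormN; lia.
Qed.

End Euclid.

(** Nine explicit fields let closed identities be decided by evaluation and symbolic ones by [ring],
    entry by entry. *)
Record mat := Mat { m11 : eis; m12 : eis; m13 : eis;
                    m21 : eis; m22 : eis; m23 : eis;
                    m31 : eis; m32 : eis; m33 : eis }.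

Section Mat.
Local Open Scope eis_scope.

Definition mone := Mat 1 0 0 0 1 0 0 0 1.
Definition mmul A B := Mat
  (m11 A * m11 B + m12 A * m21 B + m13 A * m31 B)
  (m11 A * m12 B + m12 A * m22 B + m13 A * m32 B)
  (m11 A * m13 B + m12 A * m23 B + m13 A * m33 B)
  (m21 A * m11 B + m22 A * m21 B + m23 A * m31 B)
  (m21 A * m12 B + m22 A * m22 B + m23 A * m32 B)
  (m21 A * m13 B + m22 A * m23 B + m23 A * m33 B)
  (m31 A * m11 B + m32 A * m21 B + m33 A * m31 B)
  (m31 A * m12 B + m32 A * m22 B + m33 A * m32 B)
  (m31 A * m13 B + m32 A * m23 B + m33 A * m33 B).
Definition mdet A :=
  m11 A * (m22 A * m33 A - m23 A * m32 A) - m12 A * (m21 A * m33 A - m23 A * m31 A)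
  + m13 A * (m21 A * m32 A - m22 A * m31 A).
Definition madj A := Mat
  (m22 A * m33 A - m23 A * m32 A) (m13 A * m32 A - m12 A * m33 A) (m12 A * m23 A - m13 A * m22 A)
  (m23 A * m31 A - m21 A * m33 A) (m11 A * m33 A - m13 A * m31 A) (m13 A * m21 A - m11 A * m23 A)
  (m21 A * m32 A - m22 A * m31 A) (m12 A * m31 A - m11 A * m32 A) (m11 A * m22 A - m12 A * m21 A).
Definition mscale c A := Mat
  (c * m11 A) (c * m12 A) (c * m13 A)
  (c * m21 A) (c * m22 A) (c * m23 A)
  (c * m31 A) (c * m32 A) (c * m33 A).
Definition meqb A B :=
  [&& eeqb (m11 A) (m11 B), eeqb (m12 A) (m12 B), eeqb (m13 A) (m13 B),
      eeqb (m21 A) (m21 B), eeqb (m22 A) (m22 B), eeqb (m23 A) (m23 B),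
      eeqb (m31 A) (m31 B), eeqb (m32 A) (m32 B) & eeqb (m33 A) (m33 B)].

End Mat.

Declare Scope mat_scope.
Delimit Scope mat_scope with mat.
Bind Scope mat_scope with mat.
Notation "A * B" := (mmul A B) : mat_scope.
Notation "1" := mone : mat_scope.

Ltac mat_unfold := cbv beta iota delta [mmul mscale mone mdet madj m11 m12 m13 m21 m22 m23 m31
  m32 m33].
Ltac mat_destruct :=
  repeat match goal with A : mat |- _ => destruct A end.
Ltac mat_ring := mat_destruct; mat_unfold; first [ring | f_equal; ring].

Section MatTheory.
Local Open Scope mat_scope.

Lemma mmulA A B C : A * (B * C) = A * B * C.
Proof. mat_ring. Qed.
Lemma mmul1 A : 1 * A = A.
Proof. mat_ring. Qed.
Lemma mmulr1 A : A * 1 = A.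
Proof. mat_ring. Qed.
Lemma mdetM A B : mdet (A * B) = (mdet A * mdet B)%eis.
Proof. mat_ring. Qed.
Lemma mdet_adj A : mdet (madj A) = (mdet A * mdet A)%eis.
Proof. mat_ring. Qed.
Lemma madjM A B : madj (A * B) = madj B * madj A.
Proof. mat_ring. Qed.
Lemma mscale1 A : mscale e1 A = A.
Proof. mat_ring. Qed.
Lemma mul_adj A : A * madj A = mscale (mdet A) 1.
Proof. mat_ring. Qed.
Lemma adj_mul A : madj A * A = mscale (mdet A) 1.
Proof. mat_ring. Qed.
Lemma mulV A : mdet A = e1 -> A * madj A = 1.
Proof. by move=> d; rewrite mul_adj d mscale1. Qed.
Lemma mulVl A : mdet A = e1 -> madj A * A = 1.
Proof. by move=> d; rewrite adj_mul d mscale1. Qed.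
Lemma meqbP A B : meqb A B -> A = B.
Proof.
rewrite /meqb; case/and5P=> /eeqbP h1 /eeqbP h2 /eeqbP h3 /eeqbP h4 /and5P[/eeqbP h5 /eeqbP h6
  /eeqbP h7 /eeqbP h8 /eeqbP h9].
by case: A B h1 h2 h3 h4 h5 h6 h7 h8 h9 => ????????? [*] /=; congr Mat.
Qed.

End MatTheory.

(** * Generation of SL3(Z[w]) by elementary matrices *)

Section Elementary.
Local Open Scope eis_scope.

Definition E12 x := Mat 1 x 0 0 1 0 0 0 1.
Definition E13 x := Mat 1 0 x 0 1 0 0 0 1.
Definition E23 x := Mat 1 0 0 0 1 x 0 0 1.
Definition E21 x := Mat 1 0 0 x 1 0 0 0 1.
Definition E31 x := Mat 1 0 0 0 1 0 x 0 1.
Definition E32 x := Mat 1 0 0 0 1 0 0 x 1.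

End Elementary.

Ltac elem_ring :=
  unfold E12, E13, E23, E21, E31, E32 in *; mat_ring.

Section Generation.
Variable P : mat -> Prop.
Hypotheses (P1 : P mone)
  (P12 : forall x A, P A -> P (E12 x * A)%mat) (P21 : forall x A, P A -> P (E21 x * A)%mat)
  (P23 : forall x A, P A -> P (E23 x * A)%mat) (P32 : forall x A, P A -> P (E32 x * A)%mat)
  (P13 : forall x A, P A -> P (E13 x * A)%mat).

Local Lemma P12V x A : P (E12 x * A)%mat -> P A.
Proof. by move/(P12 (- x)%eis); congr P; elem_ring. Qed.
Local Lemma P21V x A : P (E21 x * A)%mat -> P A.
Proof. by move/(P21 (- x)%eis); congr P; elem_ring. Qed.
Local Lemma P23V x A : P (E23 x * A)%mat -> P A.
Proof. by move/(P23 (- x)%eis); congr P; elem_ring. Qed.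
Local Lemma P32V x A : P (E32 x * A)%mat -> P A.
Proof. by move/(P32 (- x)%eis); congr P; elem_ring. Qed.

(** Here v is the inverse of u, and the matrix is the usual Weyl element E12(u) E21(- 1/u)
    E12(u). *)
Local Lemma P_W12 u v A : (u * v = 1)%eis -> P A -> P (Mat e0 u e0 (- v) e0 e0 e0 e0 e1 * A)%mat.
Proof.
move=> d PA.
have -> : Mat e0 u e0 (- v)%eis e0 e0 e0 e0 e1 = (E12 u * (E21 (- v) * E12 u))%mat.
  by rewrite /E12 /E21; mat_unfold; f_equal; ring [d].
by rewrite -!mmulA; apply/P12/P21/P12.
Qed.

Local Lemma P_W23 u v A : (u * v = 1)%eis -> P A -> P (Mat e1 e0 e0 e0 e0 u e0 (- v) e0 * A)%mat.
Proof.
move=> d PA.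
have -> : Mat e1 e0 e0 e0 e0 u e0 (- v)%eis e0 = (E23 u * (E32 (- v) * E23 u))%mat.
  by rewrite /E23 /E32; mat_unfold; f_equal; ring [d].
by rewrite -!mmulA; apply/P23/P32/P23.
Qed.

(** diag(u, v, w) = diag(u, 1/u, 1) diag(1, u v, 1 / (u v)), and each factor is the product of two
    Weyl elements, of parameters u and -1, respectively u v and -1. *)
Local Lemma P_diag u v w : (u * v * w = 1)%eis -> P (Mat u e0 e0 e0 v e0 e0 e0 w).
Proof.
move=> d.
have -> : Mat u e0 e0 e0 v e0 e0 e0 w =
  (Mat e0 u e0 (- (v * w)) e0 e0 e0 e0 e1 * (Mat e0 (- (1)) e0 (- - (1)) e0 e0 e0 e0 e1 *
  (Mat e1 e0 e0 e0 e0 (u * v) e0 (- w) e0 * (Mat e1 e0 e0 e0 e0 (- (1)) e0 (- - (1)) e0 *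
    mone))))%mat%eis.
  by mat_unfold; f_equal; ring [d].
apply: P_W12; first by rewrite -d; ring.
apply: P_W12; first by ring.
apply: P_W23 => //; apply: P_W23 => //; ring.
Qed.

Lemma SL3_elementary A : mdet A = e1 -> P A.
Proof.
(* Euclid's algorithm clears the entries 31, 21 and 32 in this order, those already cleared being
   kept as an invariant; the steps are proved in the reverse order. *)
pose upper A := [/\ mdet A = e1, m31 A = e0 & m21 A = e0].
have step1 B : upper B -> m32 B = e0 -> P B.
  case: B => u a b a21 v c a31 a32 w [d]; cbn [m31 m21 m32] => h31 h21 h32.
  move: d; rewrite /mdet; mat_unfold; rewrite h31 h21 h32 => d.
  have e : (u * v * w = 1)%eis by rewrite -d; ring.
  (* As u v w = 1, the factors u v and u w are the inverses of w and v. *)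
  have -> : Mat u a b e0 v c e0 e0 w =
    (E13 (b * (u * v)) * (E23 (c * (u * v)) * (E12 (a * (u * w)) * Mat u e0 e0 e0 v e0 e0 e0
      w)))%mat%eis.
    rewrite /E13 /E23 /E12; mat_unfold; f_equal; ring [e].
  by apply/P13/P23/P12/P_diag.
have step2 B : upper B -> P B.
  apply: (@eis_euclid_ind _ (fun t B => E23 t * B)%mat (fun t B
    => E32 t * B)%mat m22 m32 upper P) => //.
  1-4: by move=> t C; rewrite /E23 /E32 /=; ring.
  1,2: move=> t C [d h1 h2]; split; rewrite ?mdetM ?d /E23 /E32 /= ?h1 ?h2 /mdet /=; ring.
  1,2: by move=> t C; first [apply: P23V|apply: P32V].
have step3 B : mdet B = e1 /\ m31 B = e0 -> P B.
  apply: (@eis_euclid_ind _ (fun t B => E12 t * B)%mat (fun t B => E21 t * B)%mat m11 m21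
    (fun B => mdet B = e1 /\ m31 B = e0) P) => //.
  1-4: by move=> t C; rewrite /E12 /E21 /=; ring.
  1,2: move=> t C [d h1]; split; rewrite ?mdetM ?d /E12 /E21 /= ?h1 /mdet /=; ring.
  1,2: by move=> t C; first [apply: P12V|apply: P21V].
  by move=> C [? ?] ?; apply: step2.
apply: (@eis_euclid_ind _ (fun t B => E23 t * B)%mat (fun t B => E32 t * B)%mat m21 m31
    (fun B => mdet B = e1) P) => //.
1-4: by move=> t C; rewrite /E23 /E32 /=; ring.
1,2: move=> t C d; rewrite ?mdetM ?d /E23 /E32 /mdet /=; ring.
1,2: by move=> t C; first [apply: P23V|apply: P32V].
by move=> C ? ?; apply: step3.
Qed.

End Generation.

(** * The congruence pattern and the generated group *)

Section Pattern.
Local Open Scope eis_scope.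

Definition inP z := exists y, z = epi * y.
Definition inP2 z := exists y, z = epi * epi * y.
(** Modulo 1 - w the number w is 1, so the class of a + b w in F_3 is that of a + b. *)
Definition inPb z := Z.eqb (Z.modulo (ere z + eim z) 3) 0.
(** Since (1 - w)^2 = - 3 w, the ideal p^2 is generated by 3. *)
Definition inP2b z := Z.eqb (Z.modulo (ere z) 3) 0 && Z.eqb (Z.modulo (eim z) 3) 0.

Lemma inPP z : reflect (inP z) (inPb z).
Proof.
apply: (iffP (Z.eqb_spec _ _)) => [h|[[c d] ->]].
  (* If a + b = 3 q, then a + b w = (1 - w) ((a - q) + q w). *)
  exists (Eis (ere z - (ere z + eim z) / 3)%Z ((ere z + eim z) / 3)%Z).
  have := Z.div_mod (ere z + eim z) 3 ltac:(lia); rewrite h.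
  case: z {h} => a b; rewrite /epi /emul; cbn [ere eim]; set q := (_ / _)%Z => e.
  by apply: f_equal2; lia.
rewrite /epi /emul; cbn [ere eim].
have -> : (1 * c - -1 * d + (1 * d + -1 * c - -1 * d) = d * 3)%Z by ring.
exact: Z.mod_mul.
Qed.

Lemma inP2P z : reflect (inP2 z) (inP2b z).
Proof.
apply: (iffP andP) => [[/Z.eqb_spec h1 /Z.eqb_spec h2]|[[c d] ->]].
  (* The factor 1 + w comes from 3 = (1 - w)^2 (1 + w). *)
  exists (Eis 1 1 * Eis (ere z / 3) (eim z / 3)).
  have := Z.div_mod (ere z) 3 ltac:(lia); have := Z.div_mod (eim z) 3 ltac:(lia).
  rewrite h1 h2; case: z {h1 h2} => a b; rewrite /epi /emul; cbn [ere eim].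
  set p := (a / 3)%Z; set q := (b / 3)%Z => e e'.
  by apply: f_equal2; lia.
rewrite /epi /emul; cbn [ere eim]; split; apply/Z.eqb_spec.
  by rewrite (_ : (_ - _ = d * 3)%Z); [exact: Z.mod_mul|ring].
by rewrite (_ : (_ - _ = (d - c) * 3)%Z); [exact: Z.mod_mul|ring].
Qed.

Lemma inP_add x y : inP x -> inP y -> inP (x + y).
Proof. by case=> u -> [v ->]; exists (u + v); ring. Qed.
Lemma inP_mull x y : inP x -> inP (x * y).
Proof. by case=> u ->; exists (u * y); ring. Qed.
Lemma inP_mulr x y : inP y -> inP (x * y).
Proof. by case=> u ->; exists (x * u); ring. Qed.
Lemma inP_opp x : inP x -> inP (- x).
Proof. by case=> u ->; exists (- u); ring. Qed.
Lemma inP_sub x y : inP x -> inP y -> inP (x - y).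
Proof. by case=> u -> [v ->]; exists (u - v); ring. Qed.
Lemma inP2_add x y : inP2 x -> inP2 y -> inP2 (x + y).
Proof. by case=> u -> [v ->]; exists (u + v); ring. Qed.
Lemma inP2_mul x y : inP x -> inP y -> inP2 (x * y).
Proof. by case=> u -> [v ->]; exists (u * v); ring. Qed.
Lemma inP2_pi x : inP x -> inP2 (epi * x).
Proof. by case=> u ->; exists u; ring. Qed.
Lemma inP2_P x : inP2 x -> inP x.
Proof. by case=> u ->; exists (epi * u); ring. Qed.

Definition epow n := iter n (emul epi) e1.
Definition idl n z := exists y, z = emul (epow n) y.

Lemma idl0 z : idl 0 z.
Proof. by exists z; rewrite /epow /=; ring. Qed.
Lemma idl1 z : idl 1 z <-> inP z.
Proof. by split=> -[y ->]; exists y; rewrite /epow /=; ring. Qed.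
Lemma idl2 z : idl 2 z <-> inP2 z.
Proof. by split=> -[y ->]; exists y; rewrite /epow /=; ring. Qed.

Definition mcong (I : eis -> Prop) A :=
  [/\ [/\ I (m11 A - 1), I (m12 A) & I (m13 A)],
      [/\ I (m21 A), I (m22 A - 1) & I (m23 A)]
    & [/\ I (m31 A), I (m32 A) & I (m33 A - 1)]].

Definition upper A :=
  [/\ inP (m11 A - 1), inP (m22 A - 1) & inP (m33 A - 1)] /\
  [/\ inP (m21 A), inP (m31 A) & inP (m32 A)].
Definition upperb A :=
  [&& inPb (m11 A - 1), inPb (m22 A - 1), inPb (m33 A - 1), inPb (m21 A),
    inPb (m31 A) & inPb (m32 A)].

Lemma upperP A : reflect (upper A) (upperb A).
Proof.
apply: (iffP and5P) => [[/inPP ? /inPP ? /inPP ? /inPP ? /andP[/inPP ? /inPP ?]]|[[? ? ?]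
  [? ? ?]]] //.
by split; try apply/andP; try split; apply/inPP.
Qed.

(* Over [F_3], this is the linear condition [x12 + x23 + x31 / (1 - w) = 0]. *)
Definition trace_form A := m31 A + epi * (m12 A + m23 A).

Definition pattern A := upper A /\ inP2 (trace_form A).

Definition patternb A := upperb A && inP2b (trace_form A).

Lemma patternP A : reflect (pattern A) (patternb A).
Proof. by apply: (iffP andP) => -[/upperP ? /inP2P ?]. Qed.

Lemma pattern_one : pattern mone. Proof. exact/patternP. Qed.

Lemma upperM A B : upper A -> upper B -> upper (A * B)%mat.
Proof.
case=> [[a1 a2 a3] [a4 a5 a6]] [[b1 b2 b3] [b4 b5 b6]].
split; split; rewrite /mmul; cbn [m11 m22 m33 m21 m31 m32].
- have -> : m11 A * m11 B + m12 A * m21 B + m13 A * m31 B - 1 =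
    (m11 A - 1) * m11 B + (m11 B - 1) + m12 A * m21 B + m13 A * m31 B by ring.
  by do ![apply: inP_add | by apply: inP_mull | by apply: inP_mulr].
- have -> : m21 A * m12 B + m22 A * m22 B + m23 A * m32 B - 1 =
    m21 A * m12 B + (m22 A - 1) * m22 B + (m22 B - 1) + m23 A * m32 B by ring.
  by do ![apply: inP_add | by apply: inP_mull | by apply: inP_mulr].
- have -> : m31 A * m13 B + m32 A * m23 B + m33 A * m33 B - 1 =
    m31 A * m13 B + m32 A * m23 B + (m33 A - 1) * m33 B + (m33 B - 1) by ring.
  by do ![apply: inP_add | by apply: inP_mull | by apply: inP_mulr].
- by do ![apply: inP_add | by apply: inP_mull | by apply: inP_mulr].
- by do ![apply: inP_add | by apply: inP_mull | by apply: inP_mulr].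
- by do ![apply: inP_add | by apply: inP_mull | by apply: inP_mulr].
Qed.

(** Each cross term is a product of two elements of p, or [epi] times an element of p. So the form
    modulo p^2, whose values lie in p / p^2, is a homomorphism to a group of order 3. *)
Lemma trace_formM A B : upper A -> upper B ->
  exists2 z, inP2 z & trace_form (A * B)%mat = trace_form A + trace_form B + z.
Proof.
case=> [[a1 a2 a3] [a4 a5 a6]] [[b1 b2 b3] [b4 b5 b6]].
exists (m31 A * (m11 B - 1) + m32 A * m21 B + (m33 A - 1) * m31 B
  + epi * ((m11 A - 1) * m12 B + m12 A * (m22 B - 1) + m13 A * m32 B)
  + epi * (m21 A * m13 B + (m22 A - 1) * m23 B + m23 A * (m33 B - 1))).
  by do ![apply: inP2_add | by apply: inP2_mul | apply: inP2_pi | apply: inP_add |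
     by apply: inP_mull | by apply: inP_mulr].
by rewrite /trace_form /mmul; cbn [m31 m12 m23]; ring.
Qed.

Lemma patternM A B : pattern A -> pattern B -> pattern (A * B)%mat.
Proof.
move=> [uA tA] [uB tB]; split; first exact: upperM.
by have [z hz ->] := trace_formM uA uB; apply: inP2_add hz; apply: inP2_add.
Qed.

End Pattern.

(** * The generators over Z[w] and the words in them *)

Section Words.
Local Open Scope Z_scope.

(* [gm0 = b a], [gm1] and [gm2] are its conjugates by [a] and [a^2], and [gm3 = a^3]. *)
Definition gm0 := Mat (Eis (-1) (-1)) e1 e1 e0 e1 (Eis 1 1) e0 e0 ew.
Definition gm1 :=
  Mat (Eis (-1) (-1)) e0 (Eis 0 (-1)) (Eis (-1) (-2)) e1 e1 (Eis 2 1) (Eis (-1) 1) ew.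
Definition gm2 :=
  Mat (Eis (-1) (-1)) (Eis 2 0) e0 e0 e1 e0 epi (Eis 2 4) ew.
Definition gm3 :=
  Mat e1 (Eis 0 2) (Eis (-1) 0) (Eis 2 1) (Eis (-1) 2) (Eis (-1) 0) (Eis (-1) 1) (Eis (-3) (-3))
    (Eis 0 (-2)).

(* Letters [0] to [3] are the generators, [4] to [7] their inverses and [8] is the scalar [w]. *)
Definition letters :=
  [:: gm0; gm1; gm2; gm3; madj gm0; madj gm1; madj gm2; madj gm3; mscale ew mone].
Definition letter k := nth mone letters k.
Definition eval_word (u : seq nat) := foldr (fun k A => letter k * A)%mat mone u.

Definition Gen A := exists u, A = eval_word u.

(** An index beyond the list denotes the identity, whence the hypothesis on [mone]; so every
    sequence of numbers is a word. *)
Lemma letters_all (p : mat -> bool) : p mone -> all p letters -> forall k, p (letter k).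
Proof.
move=> p1 pl k; rewrite /letter; case: (ltnP k (size letters)) => h; last by rewrite nth_default.
exact: all_nthP.
Qed.

Lemma Gen_ind (P : mat -> Prop) :
  P mone -> (forall k A, P A -> P (letter k * A)%mat) -> forall A, Gen A -> P A.
Proof. by move=> P1 PM A [u ->]; elim: u => [|k u IH] //=; apply: PM. Qed.

Lemma Gen_letter k : Gen (letter k).
Proof. by exists [:: k]; rewrite /= mmulr1. Qed.

Lemma Gen1 : Gen mone.
Proof. by exists [::]. Qed.

Lemma GenM A B : Gen A -> Gen B -> Gen (A * B)%mat.
Proof.
case=> u -> [v ->]; exists (u ++ v).
by elim: u => [|k u IH] /=; rewrite ?mmul1 // -mmulA IH.
Qed.

Lemma mdet_letter k : mdet (letter k) = e1.
Proof. by apply: eeqbP; exact: (@letters_all (fun A => eeqb (mdet A) e1)). Qed.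

Lemma Gen_det A : Gen A -> mdet A = e1.
Proof.
move: A; apply: Gen_ind => // k A d; rewrite mdetM d mdet_letter.
by [].
Qed.

Lemma Gen_pattern A : Gen A -> pattern A.
Proof.
move: A; apply: Gen_ind => [|k A]; first exact: pattern_one.
by apply: patternM; apply/patternP; exact: (@letters_all patternb).
Qed.

Lemma Gen_word u A : meqb A (eval_word u) -> Gen A.
Proof. by move/meqbP => ->; exists u. Qed.

Lemma Gen_adj_letter k : Gen (madj (letter k)).
Proof.
(* The inverse of the scalar w is w^2, hence the word [[:: 8; 8]]; indices beyond the list get the
   empty word. *)
apply: (Gen_word (u := nth [::] [:: [:: 4]; [:: 5]; [:: 6]; [:: 7]; [:: 0]; [:: 1]; [:: 2];
  [:: 3]; [:: 8; 8]] k)%N).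
by do 9![case: k => [|k] //]; rewrite /letter !nth_default.
Qed.

Lemma Gen_adj A : Gen A -> Gen (madj A).
Proof.
move: A; apply: Gen_ind => [|k A gA]; first exact: (Gen_word (u := [::])).
by rewrite madjM; apply: GenM gA _; apply: Gen_adj_letter.
Qed.

Lemma Gen_scale A : Gen A -> Gen (mscale ew A).
Proof.
move=> gA; have -> : mscale ew A = (letter 8 * A)%mat by rewrite /letter /=; mat_ring.
by apply: GenM gA; apply: Gen_letter.
Qed.

End Words.

Section Elements.
Local Open Scope nat_scope.
(* The words were found by a breadth-first search from both ends. *)
Ltac gen_word u := apply: (@Gen_word u); vm_compute.

Lemma Gen_E13_1 : Gen (E13 e1).
Proof. by gen_word [:: 5; 2; 7; 4; 6; 5; 8; 8]. Qed.
Lemma Gen_E13_w : Gen (E13 ew).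
Proof. by gen_word [:: 7; 2; 7; 4; 6; 1; 3; 8; 8]. Qed.
Lemma Gen_E12_1 : Gen (E12 (epi * e1)%eis).
Proof. by gen_word [:: 6; 5; 6; 0; 1; 6; 4; 8]. Qed.
Lemma Gen_E12_w : Gen (E12 (epi * ew)%eis).
Proof. by gen_word [:: 2; 7; 5; 4; 6; 5; 0; 5; 3; 8]. Qed.
Lemma Gen_E23_1 : Gen (E23 (epi * e1)%eis).
Proof. by gen_word [:: 0; 6; 0; 3; 6; 1; 0; 7; 6; 5]. Qed.
Lemma Gen_E23_w : Gen (E23 (epi * ew)%eis).
Proof. by gen_word [:: 1; 3; 5; 4; 7; 6; 4; 2; 4]. Qed.
Lemma Gen_E21_1 : Gen (E21 (epi * e1)%eis).
Proof. by gen_word [:: 3; 3; 1; 2; 5; 0; 5; 4]. Qed.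
Lemma Gen_E21_w : Gen (E21 (epi * ew)%eis).
Proof. by gen_word [:: 1; 4; 2; 5; 7; 0; 5]. Qed.
Lemma Gen_E32_1 : Gen (E32 (epi * e1)%eis).
Proof. by gen_word [:: 0; 1; 6; 7; 5; 8; 8]. Qed.
Lemma Gen_E32_w : Gen (E32 (epi * ew)%eis).
Proof. by gen_word [:: 3; 6; 1; 7; 7; 0; 5; 8; 8]. Qed.
Lemma Gen_E31_1 : Gen (E31 (epi * epi * e1)%eis).
Proof. by gen_word [:: 5; 7; 6; 3; 6; 4; 5; 6; 0; 5; 8]. Qed.
Lemma Gen_E31_w : Gen (E31 (epi * epi * ew)%eis).
Proof. by gen_word [:: 0; 2; 3; 6; 5; 7; 5; 4; 5]. Qed.
(** This element and the next are quotients of two simple affine root elements, on which the form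
    takes equal values. Once E12(1) is adjoined, they yield E23(1) and E31(1 - w). *)
Lemma Gen_E12_E23 : Gen (E12 e1 * E23 (- e1)%eis)%mat.
Proof. by gen_word [:: 4; 6; 0; 2; 7; 0; 1; 4; 8]. Qed.
Lemma Gen_E12_E31 : Gen (E12 e1 * E31 (- epi)%eis)%mat.
Proof. by gen_word [:: 2; 4; 5; 0; 2; 1; 8; 8]. Qed.
(** With the next three words, this is the whole content of the stability of [Gen] under conjugation
    by E12(1). *)
Lemma Gen_conj0 : Gen (E12 e1 * gm0 * E12 (- e1)%eis)%mat.
Proof. by gen_word [:: 0; 1; 3; 2; 0; 1; 6]. Qed.
Lemma Gen_conj1 : Gen (E12 e1 * gm1 * E12 (- e1)%eis)%mat.
Proof. by gen_word [:: 4; 6; 5; 0; 6; 3; 2]. Qed.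
Lemma Gen_conj2 : Gen (E12 e1 * gm2 * E12 (- e1)%eis)%mat.
Proof. by gen_word [:: 1; 2; 7; 4; 1; 3; 2; 1; 3]. Qed.
Lemma Gen_conj3 : Gen (E12 e1 * gm3 * E12 (- e1)%eis)%mat.
Proof. by gen_word [:: 2; 1; 0; 2; 3; 2; 0; 1; 6]. Qed.
End Elements.

(** * Root subgroups in [Gen], and the group generated by [Gen] and E12(1) *)

Section Normalizer.
Local Open Scope eis_scope.

(** The ideal (a) is generated by a and a w as an additive group, so two words suffice for each root
    subgroup. *)
Lemma eis_lattice (Q : eis -> Prop) a :
  (forall x y, Q x -> Q y -> Q (x + y)) -> (forall x, Q x -> Q (- x)) ->
  Q (a * 1) -> Q (a * ew) -> forall x, Q (a * x).
Proof.
move=> QD QN Q1 Qw.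
have Q0 : Q 0 by have := QD _ _ Q1 (QN _ Q1); congr Q; ring.
have Qnat b n : Q b -> Q (Eis (Z.of_nat n) 0%Z * b).
  move=> Qb; elim: n => [|n IH]; first by move: Q0; congr Q; ring.
  have := QD _ _ IH Qb; congr Q; rewrite Nat2Z.inj_succ /Z.succ.
  by case: b {Qb IH} => c d; rewrite /emul /eadd; cbn [ere eim]; apply: f_equal2; ring.
have QZ b n : Q b -> Q (Eis n 0%Z * b).
  move=> Qb; case: (Z.le_gt_cases 0 n) => hn.
    by rewrite -(Z2Nat.id n) //; apply: Qnat.
  have := QN _ (Qnat b (Z.to_nat (- n)) Qb); congr Q; rewrite Z2Nat.id; last lia.
  by rewrite /emul /eopp; cbn [ere eim]; apply: f_equal2; ring.
move=> [c d]; have := QD _ _ (QZ _ c Q1) (QZ _ d Qw); congr Q.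
by case: a {Q1 Qw} => p q; rewrite /emul /eadd; cbn [ere eim ew e1]; apply: f_equal2; ring.
Qed.

Lemma root_subgroup (S : mat -> Prop) (E : eis -> mat) a :
  (forall A B, S A -> S B -> S (A * B)%mat) -> (forall A, S A -> S (madj A)) ->
  (forall x y, E (x + y) = (E x * E y)%mat) -> (forall x, E (- x) = madj (E x)) ->
  S (E (a * 1)) -> S (E (a * ew)) -> forall x, S (E (a * x)).
Proof.
move=> SM SV ED EN S1 Sw; apply: (@eis_lattice (fun x => S (E x))) => //.
- by move=> x y Sx Sy; rewrite ED; apply: SM.
- by move=> x Sx; rewrite EN; apply: SV.
Qed.

Lemma Gen_E13 x : Gen (E13 x).
Proof.
rewrite (_ : x = 1 * x); last ring.
by apply: (root_subgroup GenM Gen_adj) _ _ Gen_E13_1 Gen_E13_w _ => *; elem_ring.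
Qed.

Lemma Gen_E12 x : Gen (E12 (epi * x)).
Proof. by apply: (root_subgroup GenM Gen_adj) _ _ Gen_E12_1 Gen_E12_w _ => *; elem_ring. Qed.

Lemma Gen_E23 x : Gen (E23 (epi * x)).
Proof. by apply: (root_subgroup GenM Gen_adj) _ _ Gen_E23_1 Gen_E23_w _ => *; elem_ring. Qed.

Lemma Gen_E21 x : Gen (E21 (epi * x)).
Proof. by apply: (root_subgroup GenM Gen_adj) _ _ Gen_E21_1 Gen_E21_w _ => *; elem_ring. Qed.

Lemma Gen_E32 x : Gen (E32 (epi * x)).
Proof. by apply: (root_subgroup GenM Gen_adj) _ _ Gen_E32_1 Gen_E32_w _ => *; elem_ring. Qed.

Lemma Gen_E31 x : Gen (E31 (epi * epi * x)).
Proof. by apply: (root_subgroup GenM Gen_adj) _ _ Gen_E31_1 Gen_E31_w _ => *; elem_ring. Qed.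

Definition conj12 x A := (E12 x * A * E12 (- x))%mat.

Lemma conj12M x A B : conj12 x (A * B)%mat = (conj12 x A * conj12 x B)%mat.
Proof.
have e : (E12 (- x) * E12 x)%mat = mone by elem_ring.
have -> : (conj12 x A * conj12 x B = E12 x * A * (E12 (- x) * E12 x) * B * E12 (- x))%mat.
  by rewrite /conj12 !mmulA.
by rewrite e mmulr1 /conj12 !mmulA.
Qed.

Lemma conj12_adj x A : madj (conj12 x A) = conj12 x (madj A).
Proof.
have e y : madj (E12 y) = E12 (- y) by elem_ring.
have eN : - - x = x by ring.
by rewrite /conj12 !madjM !e eN mmulA.
Qed.

Lemma conj12D x y A : conj12 (x + y) A = conj12 x (conj12 y A).
Proof.
have e : E12 (x + y) = (E12 x * E12 y)%mat by elem_ring.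
have e' : E12 (- (x + y)) = (E12 (- y) * E12 (- x))%mat by elem_ring.
by rewrite /conj12 e e' !mmulA.
Qed.

Lemma Gen_conj12_1 A : Gen A -> Gen (conj12 1 A).
Proof.
move: A; apply: Gen_ind => [|k A gA].
  by have := Gen1; congr Gen; rewrite /conj12; elem_ring.
rewrite conj12M; apply: GenM gA.
have c0 := Gen_conj0; have c1 := Gen_conj1; have c2 := Gen_conj2; have c3 := Gen_conj3.
have [[[d0 d1] d2] d3] := (Gen_adj c0, Gen_adj c1, Gen_adj c2, Gen_adj c3).
rewrite -/(conj12 1 _) in c0 c1 c2 c3 d0 d1 d2 d3; rewrite !conj12_adj in d0 d1 d2 d3.
case: k => [|[|[|[|[|[|[|[|[|k]]]]]]]]].
- exact: c0.
- exact: c1.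
- exact: c2.
- exact: c3.
- exact: d0.
- exact: d1.
- exact: d2.
- exact: d3.
- by have := Gen_scale Gen1; congr Gen; rewrite /conj12 /letter; cbn [nth letters]; elem_ring.
have -> : letter k.+1.+4.+4 = mone by rewrite /letter nth_default.
by have := Gen1; congr Gen; rewrite /conj12; elem_ring.
Qed.

Lemma Gen_conj12 n A : Gen A -> Gen (conj12 (Eis n 0) A).
Proof.
have pos m B : (0 <= m)%Z -> Gen B -> Gen (conj12 (Eis m 0) B).
  move=> m0; rewrite -(Z2Nat.id m) //; elim: (Z.to_nat m) B => [|k IH] B gB.
    by move: gB; congr Gen; rewrite /conj12; elem_ring.
  have -> : Eis (Z.of_nat k.+1) 0 = 1 + Eis (Z.of_nat k) 0.
    by rewrite Nat2Z.inj_succ /Z.succ /eadd; cbn [ere eim e1]; apply: f_equal2; ring.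
  by rewrite conj12D; apply/Gen_conj12_1/IH.
move=> gA; case: (Z.le_gt_cases 0 n) => hn; first exact: pos.
have e x : Eis (3 * x)%Z 0%Z = epi * Eis (2 * x)%Z x.
  by rewrite /emul /epi; cbn [ere eim]; apply: f_equal2; ring.
(* Only positive powers of E12(1) are known to act. For n < 0, write n = 3 n + (- 2 n): E12(3 n)
   lies in [Gen] because 3 lies in p, and - 2 n is positive. *)
have -> : Eis n 0%Z = Eis (3 * n)%Z 0%Z + Eis (-2 * n)%Z 0%Z.
  by rewrite /eadd; cbn [ere eim]; apply: f_equal2; ring.
rewrite conj12D; apply: GenM; first apply: GenM.
- by rewrite e; apply: Gen_E12.
- by apply: pos => //; lia.
- rewrite (_ : - Eis (3 * n) 0 = epi * Eis (2 * - n) (- n)); first exact: Gen_E12.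
  by rewrite -e /eopp; cbn [ere eim]; apply: f_equal2; ring.
Qed.

(* This turns out to be the pro-3 Iwahori group of all matrices of determinant [1] that are
   upper unitriangular modulo [1 - w]. *)
Definition Iw A := exists n, Gen (E12 (Eis (- n)%Z 0%Z) * A)%mat.

Lemma Iw_Gen A : Gen A -> Iw A.
Proof. by move=> gA; exists 0%Z; rewrite (_ : E12 _ = mone) ?mmul1. Qed.

Lemma IwE A : Iw A -> exists n B, Gen B /\ A = (E12 (Eis n 0) * B)%mat.
Proof.
case=> n gA; exists n, (E12 (Eis (- n)%Z 0%Z) * A)%mat; split=> //; rewrite mmulA.
have -> : (E12 (Eis n 0) * E12 (Eis (- n) 0))%mat = mone; last by rewrite mmul1.
have -> : Eis (- n)%Z 0%Z = - Eis n 0%Z by [].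
elem_ring.
Qed.

Lemma E12_Z m n : E12 (Eis (m + n) 0) = (E12 (Eis m 0) * E12 (Eis n 0))%mat.
Proof.
have -> : Eis (m + n) 0 = Eis m 0 + Eis n 0 by [].
elem_ring.
Qed.

Lemma E12_NZ m : (E12 (Eis (- m) 0) * E12 (Eis m 0))%mat = mone.
Proof. by rewrite -E12_Z Z.add_opp_diag_l. Qed.

Lemma Iw_E12B n A : Gen A -> Iw (E12 (Eis n 0) * A)%mat.
Proof. by move=> gA; exists n; rewrite mmulA E12_NZ mmul1. Qed.

Lemma IwM A B : Iw A -> Iw B -> Iw (A * B)%mat.
Proof.
move=> /IwE[m [C [gC ->]]] /IwE[n [D [gD ->]]].
have -> : (E12 (Eis m 0) * C * (E12 (Eis n 0) * D) =
  E12 (Eis (m + n) 0) * (conj12 (Eis (- n) 0) C * D))%mat.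
  have en : (E12 (Eis n 0) * E12 (Eis (- n) 0))%mat = mone by rewrite -E12_Z Z.add_opp_diag_r.
  have e : E12 (- Eis (- n) 0) = E12 (Eis n 0) by rewrite /eopp; cbn [ere eim];
    rewrite Z.opp_involutive.
  by rewrite /conj12 e E12_Z -!mmulA; congr (_ * _)%mat; rewrite (mmulA (E12 (Eis n 0))) en mmul1.
by apply: Iw_E12B; apply: GenM => //; apply: Gen_conj12.
Qed.

Lemma Iw_adj A : Iw A -> Iw (madj A).
Proof.
move=> /IwE[m [C [gC ->]]]; exists (- m)%Z; rewrite madjM Z.opp_involutive.
have -> : (E12 (Eis m 0) * (madj C * madj (E12 (Eis m 0))) = conj12 (Eis m 0) (madj C))%mat.
  have -> : madj (E12 (Eis m 0)) = E12 (- Eis m 0) by elem_ring.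
  by rewrite /conj12 mmulA.
by apply: Gen_conj12; apply: Gen_adj.
Qed.

Lemma Iw_E12_1 : Iw (E12 1).
Proof. by exists 1%Z; have := Gen1; congr Gen; rewrite /E12; mat_unfold; f_equal; ring. Qed.

Lemma Iw_E12 x : Iw (E12 x).
Proof.
rewrite (_ : x = 1 * x); last ring.
apply: (root_subgroup IwM Iw_adj) _ _ Iw_E12_1 _ _ => *; try by elem_ring.
(* The second generator is reached from w = 1 - (1 - w). *)
by have := IwM Iw_E12_1 (Iw_Gen (Gen_E12 (- e1)%eis)); congr Iw; elem_ring.
Qed.

Lemma Iw_E13 x : Iw (E13 x).
Proof. exact/Iw_Gen/Gen_E13. Qed.

Lemma Iw_E23_1 : Iw (E23 1).
Proof.
have := IwM (Iw_adj (Iw_Gen Gen_E12_E23)) Iw_E12_1.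
by congr Iw; elem_ring.
Qed.

Lemma Iw_E23 x : Iw (E23 x).
Proof.
rewrite (_ : x = 1 * x); last ring.
apply: (root_subgroup IwM Iw_adj) _ _ Iw_E23_1 _ _ => *; try by elem_ring.
by have := IwM Iw_E23_1 (Iw_Gen (Gen_E23 (- e1)%eis)); congr Iw; elem_ring.
Qed.

Lemma Iw_E31_1 : Iw (E31 (epi * 1)).
Proof.
have := IwM (Iw_adj (Iw_Gen Gen_E12_E31)) Iw_E12_1.
by congr Iw; elem_ring.
Qed.

Lemma Iw_E31 x : Iw (E31 (epi * x)).
Proof.
apply: (root_subgroup IwM Iw_adj) _ _ Iw_E31_1 _ _ => *; try by elem_ring.
by have := IwM Iw_E31_1 (Iw_Gen (Gen_E31 (- e1)%eis)); congr Iw; elem_ring.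
Qed.

Lemma Iw_upper A : Iw A -> upper A.
Proof.
move=> /IwE[m [C [/Gen_pattern[uC _] ->]]]; apply: upperM => //.
by split; split; rewrite /E12 /=; exists 0; ring.
Qed.

(* The form [trace_form] separates the cosets of [Gen] in [Iw]. *)
Lemma Iw_pattern A : Iw A -> pattern A -> Gen A.
Proof.
move=> /IwE[m [C [gC ->]]] [_ tA]; apply: GenM => //.
have [uC tC] := Gen_pattern gC.
have uE : upper (E12 (Eis m 0)) by split; split; rewrite /E12 /=; exists 0; ring.
have [z hz e] := trace_formM uE uC.
(* The form of E12(m) is [epi * m]. Additivity puts it in p^2, so 3 divides m and E12(m) is itself
   in [Gen]. *)
have /inP2P : inP2 (epi * Eis m 0).
  have -> : epi * Eis m 0 = trace_form (E12 (Eis m 0) * C)%mat + - (trace_form C + z).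
    by rewrite e /trace_form /E12; cbn [m31 m12 m23]; ring.
  apply: inP2_add => //; have [y ->] := inP2_add tC hz; exists (- y); ring.
rewrite /epi /inP2b /emul; cbn [ere eim] => /andP[/Z.eqb_spec h _].
have hm : m = (3 * (m / 3))%Z.
  by have := Z.div_mod m 3 ltac:(lia); rewrite (_ : 1 * m - -1 * 0 = m)%Z in h; lia.
rewrite hm (_ : Eis _ _ = epi * Eis (2 * (m / 3))%Z (m / 3)); first exact: Gen_E12.
by rewrite /emul /epi; cbn [ere eim]; apply: f_equal2; ring.
Qed.

End Normalizer.

(** * Bruhat decomposition *)

Section Bruhat.
Local Open Scope eis_scope.

Definition n12 := Mat 0 1 0 (- (1)) 0 0 0 0 1.
Definition n23 := Mat 1 0 0 0 0 1 0 (- (1)) 0.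
Definition mdiag x y z := Mat x 0 0 0 y 0 0 0 z.

(** Four diagonal sign matrices times lifts of the six permutations. The list makes every statement
    about these 24 matrices a computation. *)
Definition Weyl_seq :=
  [seq (d * w)%mat | d <- [:: mone; mdiag (- (1)) (- (1)) 1; mdiag (- (1)) 1 (- (1));
    mdiag 1 (- (1)) (- (1))],
    w <- [:: mone; n12; n23; n12 * n23; n23 * n12; n12 * n23 * n12]%mat].
Definition Weyl w := has (meqb w) Weyl_seq.

Lemma Weyl_all (p : mat -> bool) : all p Weyl_seq -> forall w, Weyl w -> p w.
Proof.
by rewrite /Weyl; elim: Weyl_seq => //= v s IH /andP[pv ps] w /orP[/meqbP->|/IH]; last exact.
Qed.

Lemma Weyl_det w : Weyl w -> mdet w = e1.
Proof.
by move=> h; apply: eeqbP; move: h; apply: (@Weyl_all (fun w => eeqb (mdet w) e1)); vm_compute.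
Qed.

Lemma Weyl_n12 w : Weyl w -> Weyl (n12 * w)%mat.
Proof. by move: w; apply: Weyl_all; vm_compute. Qed.

Lemma Weyl_n23 w : Weyl w -> Weyl (n23 * w)%mat.
Proof. by move: w; apply: Weyl_all; vm_compute. Qed.

(** This is d + x (A - d). A root element is E(x) = 1 + x (E(1) - 1), so its conjugates are known
    from those of E(1); the parameter d, to be set to the determinant, turns [mlin_conj] into a
    polynomial identity. *)
Definition mlin d x A := Mat
  (d + x * (m11 A - d)) (x * m12 A) (x * m13 A)
  (x * m21 A) (d + x * (m22 A - d)) (x * m23 A)
  (x * m31 A) (x * m32 A) (d + x * (m33 A - d)).

Lemma mlin_conj w x A : mdet w = e1 ->
  (madj w * mlin 1 x A * w = mlin 1 x (madj w * A * w))%mat.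
Proof.
move=> d; have -> : (madj w * mlin 1 x A * w = mlin (mdet w) x (madj w * A * w))%mat.
  by mat_destruct; rewrite /mlin; mat_unfold; f_equal; ring.
by rewrite d.
Qed.

(** Conjugation by a signed permutation matrix sends E(1) for one root to E(1) or E(-1) for another,
    whence the two signs. *)
Definition pos_root A :=
  has (meqb A) [:: E12 1; E13 1; E23 1; E12 (- (1)); E13 (- (1)); E23 (- (1))].
Definition neg_root A :=
  has (meqb A) [:: E21 1; E31 1; E32 1; E21 (- (1)); E31 (- (1)); E32 (- (1))].

Lemma Iw_pos_root A x : pos_root A -> Iw (mlin 1 x A).
Proof.
case/orP=> [/meqbP->|]; first by have := Iw_E12 x; congr Iw; rewrite /mlin; elem_ring.
case/orP=> [/meqbP->|]; first by have := Iw_E13 x; congr Iw; rewrite /mlin; elem_ring.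
case/orP=> [/meqbP->|]; first by have := Iw_E23 x; congr Iw; rewrite /mlin; elem_ring.
case/orP=> [/meqbP->|]; first by have := Iw_E12 (- x); congr Iw; rewrite /mlin; elem_ring.
case/orP=> [/meqbP->|]; first by have := Iw_E13 (- x); congr Iw; rewrite /mlin; elem_ring.
case/orP=> [/meqbP->|//]; by have := Iw_E23 (- x); congr Iw; rewrite /mlin; elem_ring.
Qed.

Lemma Iw_neg_root A x : neg_root A -> Iw (mlin 1 (epi * x) A).
Proof.
have I21 y : Iw (E21 (epi * y)) by exact/Iw_Gen/Gen_E21.
have I32 y : Iw (E32 (epi * y)) by exact/Iw_Gen/Gen_E32.
case/orP=> [/meqbP->|]; first by have := I21 x; congr Iw; rewrite /mlin; elem_ring.
case/orP=> [/meqbP->|]; first by have := Iw_E31 x; congr Iw; rewrite /mlin; elem_ring.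
case/orP=> [/meqbP->|]; first by have := I32 x; congr Iw; rewrite /mlin; elem_ring.
case/orP=> [/meqbP->|]; first by have := I21 (- x); congr Iw; rewrite /mlin; elem_ring.
case/orP=> [/meqbP->|]; first by have := Iw_E31 (- x); congr Iw; rewrite /mlin; elem_ring.
case/orP=> [/meqbP->|//]; by have := I32 (- x); congr Iw; rewrite /mlin; elem_ring.
Qed.

(** The representatives 0, 1, -1 are chosen because the nonzero ones are units, as the rank one
    identity requires. *)
Lemma eis_mod_pi x : exists e y, [\/ e = 0, e = 1 | e = - (1)] /\ x = e + epi * y.
Proof.
case: x => a b; pose m := ((a + b) mod 3)%Z.
have hm := Z.mod_pos_bound (a + b) 3 ltac:(lia); rewrite -/m in hm.
have hP n : (m = n mod 3)%Z -> exists y, Eis a b = Eis n 0 + epi * y.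
  move=> h; have /inPP[y hy] : inPb (Eis (a - n) b).
    rewrite /inPb; cbn [ere eim]; rewrite (_ : a - n + b = (a + b) - n)%Z; last ring.
    by rewrite Zminus_mod -/m h Z.sub_diag.
  exists y; rewrite -hy /eadd; cbn [ere eim]; apply: f_equal2; ring.
have [h|[h|h]] : (m = 0 \/ m = 1 \/ m = 2)%Z by lia.
- by have [y hy] := hP 0%Z h; exists 0, y; split=> //; constructor 1.
- by have [y hy] := hP 1%Z h; exists 1, y; split=> //; constructor 2.
- by have [y hy] := hP (-1)%Z h; exists (- (1)), y; split=> //; constructor 3.
Qed.

(* [n E e] lies in [E (- e) T E' e] for [e = 1, -1]: this replaces the root group
   element of a negative affine root by a positive one. *)
Lemma Bruhat_rank1 (n : mat) (E E' : eis -> mat) :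
  (forall w, Weyl w -> Weyl (n * w)%mat) ->
  (forall x, E x = mlin 1 x (E 1)) -> (forall x, E' x = mlin 1 x (E' 1)) ->
  (forall x y, E (x + y) = (E x * E y)%mat) ->
  (forall e, [\/ e = 0, e = 1 | e = - (1)] -> e <> 0 ->
    exists2 D, (n * E e = E (- e) * D * E' e)%mat & forall w, Weyl w -> Weyl (D * w)%mat) ->
  (forall w, Weyl w ->
    pos_root (madj w * E e1 * w)%mat || 
    neg_root (madj w * E e1 * w)%mat && pos_root (madj w * E' e1 * w)%mat) ->
  forall x w, Weyl w -> exists y w' g, [/\ Weyl w', Iw g & (n * E x * w = E y * w' * g)%mat].
Proof.
move=> nW linE linE' ED rank1 roots x w Ww.
have dw := Weyl_det Ww; have wV := mulV dw; have E0 : E 0 = mone.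
  by rewrite linE; case: (E 1) => *; rewrite /mlin; mat_unfold; f_equal; ring.
have conjE z : (madj w * E z * w = mlin 1 z (madj w * E e1 * w))%mat.
  by rewrite {1}linE mlin_conj.
have conjE' z : (madj w * E' z * w = mlin 1 z (madj w * E' e1 * w))%mat.
  by rewrite {1}linE' mlin_conj.
have easy : Iw (madj w * E x * w)%mat ->
    exists y w' g, [/\ Weyl w', Iw g & (n * E x * w = E y * w' * g)%mat].
  move=> Ig; exists 0, (n * w)%mat, (madj w * E x * w)%mat; split=> //; first exact: nW.
  by rewrite E0 mmul1 !mmulA -(mmulA n w) wV mmulr1.
case/orP: (roots w Ww) => [pos|/andP[neg pos]].
  by apply: easy; rewrite conjE; apply: Iw_pos_root.
(* When the conjugated root is negative, only parameters in p are harmless, so E(x) is split as E(e)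
   E(p y). The second factor passes to the right; the first is absorbed by the rank one identity
   unless e = 0. *)
have [e [y [he ex]]] := eis_mod_pi x; rewrite ex in easy *.
have [e0'|ne0] : e = 0 \/ e <> 0 by case: he => ->; [left|right|right].
  apply: easy; rewrite e0' (_ : 0 + epi * y = epi * y); last ring.
  by rewrite conjE; apply: Iw_neg_root.
have [D De DW] := rank1 e he ne0.
exists (- e), (D * w)%mat, ((madj w * E' e * w) * (madj w * E (epi * y)%eis * w))%mat; split.
- exact: DW.
- by apply: IwM; [rewrite conjE'; apply: Iw_pos_root|rewrite conjE; apply: Iw_neg_root].
- by rewrite ED mmulA De !mmulA -!(mmulA _ w (madj w)) wV !mmulr1.
Qed.

Lemma Bruhat_12 x w : Weyl w -> exists y w' g, [/\ Weyl w',
  Iw g & (n12 * E12 x * w = E12 y * w' * g)%mat].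
Proof.
apply: (@Bruhat_rank1 n12 E12 E21).
- exact: Weyl_n12.
- by move=> z; rewrite /mlin; elem_ring.
- by move=> z; rewrite /mlin; elem_ring.
- by move=> z t; elem_ring.
- move=> e [->|->|->] // _.
    by exists (mdiag (- (1)) (- (1)) 1); [apply: meqbP|apply: Weyl_all]; vm_compute.
  by exists mone; [apply: meqbP|apply: Weyl_all]; vm_compute.
- by apply: Weyl_all; vm_compute.
Qed.

Lemma Bruhat_23 x w : Weyl w -> exists y w' g, [/\ Weyl w',
  Iw g & (n23 * E23 x * w = E23 y * w' * g)%mat].
Proof.
apply: (@Bruhat_rank1 n23 E23 E32).
- exact: Weyl_n23.
- by move=> z; rewrite /mlin; elem_ring.
- by move=> z; rewrite /mlin; elem_ring.
- by move=> z t; elem_ring.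
- move=> e [->|->|->] // _.
    by exists (mdiag 1 (- (1)) (- (1))); [apply: meqbP|apply: Weyl_all]; vm_compute.
  by exists mone; [apply: meqbP|apply: Weyl_all]; vm_compute.
- by apply: Weyl_all; vm_compute.
Qed.

Definition upt a b c := Mat 1 a b 0 1 c 0 0 1.

Definition cell A := exists a b c w g, [/\ Weyl w, Iw g & A = (upt a b c * w * g)%mat].

Lemma cell_upt a b c A : cell A -> cell (upt a b c * A)%mat.
Proof.
case=> a' [b' [c' [w [g [Ww Ig ->]]]]].
exists (a + a'), (b + b' + a * c'), (c + c'), w, g; split=> //.
have -> : upt (a + a') (b + b' + a * c') (c + c') = (upt a b c * upt a' b' c')%mat.
  by rewrite /upt; mat_ring.
by rewrite !mmulA.
Qed.

(** The matrices [upt 0 b c] form the unipotent radical of a parabolic subgroup and are normalized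
    by [n12]; only the factor E12(a) remains, which is the rank one case. *)
Lemma cell_n12 A : cell A -> cell (n12 * A)%mat.
Proof.
case=> a [b [c [w [g [Ww Ig ->]]]]].
have [y [w' [h [Ww' Ih e]]]] := Bruhat_12 a Ww.
have -> : upt a b c = (upt 0 b c * E12 a)%mat by rewrite /upt; elem_ring.
rewrite !mmulA (_ : n12 * upt 0 b c = upt 0 c (- b) * n12)%mat; last by rewrite /upt /n12;
  mat_ring.
rewrite -!mmulA; apply: cell_upt; rewrite !mmulA e.
rewrite -!mmulA (_ : E12 y = upt y 0 0) //; apply: cell_upt.
exists 0, 0, 0, w', (h * g)%mat; split=> //; first exact: IwM.
by rewrite (_ : upt 0 0 0 = mone) // mmul1.
Qed.

Lemma cell_n23 A : cell A -> cell (n23 * A)%mat.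
Proof.
case=> a [b [c [w [g [Ww Ig ->]]]]].
have [y [w' [h [Ww' Ih e]]]] := Bruhat_23 c Ww.
have -> : upt a b c = (upt a (b - a * c) 0 * E23 c)%mat by rewrite /upt; elem_ring.
rewrite !mmulA (_ : n23 * upt a (b - a * c) 0 = upt (b - a * c) (- a) 0 * n23)%mat;
  last by rewrite /upt /n23; mat_ring.
rewrite -!mmulA; apply: cell_upt; rewrite !mmulA e.
rewrite -!mmulA (_ : E23 y = upt 0 0 y) //; apply: cell_upt.
exists 0, 0, 0, w', (h * g)%mat; split=> //; first exact: IwM.
by rewrite (_ : upt 0 0 0 = mone) // mmul1.
Qed.

Lemma cell_all A : mdet A = e1 -> cell A.
Proof.
apply: SL3_elementary.
- exists 0, 0, 0, mone, mone; split=> //.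
  exact/Iw_Gen/Gen1.
- by move=> x B /(cell_upt x 0 0).
(* E21(x) is the conjugate of E12(- x) by [n12], and the inverse of [n12] is its cube. *)
- move=> x B cB; have -> : (E21 x * B = n12 * (E12 (- x) * (n12 * (n12 * (n12 * B)))))%mat.
    by rewrite !mmulA; congr (_ * _)%mat; rewrite /n12; elem_ring.
  by apply: cell_n12; apply: (@cell_upt _ 0 0); do !apply: cell_n12.
- by move=> x B /(cell_upt 0 0 x).
- move=> x B cB; have -> : (E32 x * B = n23 * (E23 (- x) * (n23 * (n23 * (n23 * B)))))%mat.
    by rewrite !mmulA; congr (_ * _)%mat; rewrite /n23; elem_ring.
  by apply: cell_n23; apply: (@cell_upt 0 0); do !apply: cell_n23.
- by move=> x B /(cell_upt 0 x 0).
Qed.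

Lemma upper_upt a b c : upper (upt a b c).
Proof. by split; split; rewrite /upt; cbn [m11 m22 m33 m21 m31 m32]; exists 0; ring. Qed.

Lemma GenP A : Gen A <-> mdet A = e1 /\ pattern A.
Proof.
split=> [gA|[dA pA]]; first by split; [apply: Gen_det|apply: Gen_pattern].
apply: Iw_pattern => //.
have [a [b [c [w [g [Ww Ig eA]]]]]] := cell_all dA.
have Iu : Iw (upt a b c).
  have := IwM (Iw_E13 b) (IwM (Iw_E23 c) (Iw_E12 a)).
  by congr Iw; rewrite /upt; elem_ring.
have ww : w = (madj (upt a b c) * A * madj g)%mat.
  have dg : mdet g = e1.
    by move: dA; rewrite eA !mdetM (Weyl_det Ww) => <-; rewrite /upt; mat_unfold; ring.
  have du : mdet (upt a b c) = e1 by rewrite /upt; mat_unfold; ring.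
  by rewrite eA !mmulA mulVl // mmul1 -mmulA mulV // mmulr1.
have uw : upper w.
  by rewrite ww; apply: upperM; [apply: upperM;
    [exact/Iw_upper/Iw_adj|case: pA]|exact/Iw_upper/Iw_adj].
(* A signed permutation matrix that is unitriangular modulo p is the identity, signs included,
   because -1 and 1 differ in F_3. *)
have w1 : w = mone.
  move: (Weyl_all (p := fun w => upperb w ==> meqb w mone) isT Ww).
  by move/upperP: uw => -> /meqbP.
by rewrite eA w1 mmulr1; apply: IwM.
Qed.

End Bruhat.

(** * Coset representatives *)

Section Flags.
Local Open Scope eis_scope.

Definition residue z := Z.modulo (ere z + eim z)%Z 3.

Lemma residueP x y : residue x = residue y <-> inP (x - y).
Proof.
rewrite /residue; split=> [h|/inPP].
  apply/inPP/Z.eqb_spec; rewrite /esub; cbn [ere eim].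
  by rewrite (_ : (_ + _ = (ere x + eim x) - (ere y + eim y))%Z);
    [rewrite Zminus_mod h Z.sub_diag|ring].
move/Z.eqb_spec; rewrite /esub; cbn [ere eim] => h.
have := Z.div_mod (ere x - ere y + (eim x - eim y)) 3 ltac:(lia); rewrite h => e.
rewrite (_ : (ere x + eim x = ere y + eim y + (ere x - ere y + (eim x - eim y)) / 3 * 3)%Z);
  last lia.
exact: Z_mod_plus_full.
Qed.

(* Over [F_3], the vector [A e1] and the linear form [e3^T A^-1] determine the coset of [A] modulo
   the upper unitriangular group. *)
Definition flag A := let B := madj A in
  [:: residue (m11 A); residue (m21 A); residue (m31 A);
      residue (m31 B); residue (m32 B); residue (m33 B)].
Definition flag_eqb := all2 Z.eqb.

(** The Bruhat decomposition over F_3 suggests the 27 * 24 candidates; the fold keeps one matrix for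
    each flag. *)
Definition flag_seq :=
  let F3 := [:: 0; 1; - (1)] in
  let cells := [seq (E12 x * A)%mat | x <- F3, A <- [seq (E13 y * A)%mat | y <- F3,
    A <- [seq (E23 z * A)%mat | z <- F3, A <- Weyl_seq]]] in
  foldr (fun A s => let c := flag A in
    if has (fun p => flag_eqb c p.1) s then s else (c, A) :: s) [::] cells.

Lemma flag_seq_ok :
  (size flag_seq == 208) && all (fun p => flag_eqb (flag p.2) p.1 && eeqb (mdet p.2) 1) flag_seq
  && pairwise (fun p q => ~~ flag_eqb p.1 q.1) flag_seq.
Proof. by vm_compute. Qed.

Definition F3 := [:: 0; 1; 2]%Z.

(** The entries run over 0, 1, 2 as integers, so a zero sum means that the vector or the linear form
    is zero; the third test discards the forms that do not vanish on the vector. *)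
Lemma flag_seq_full :
  all (fun a => all (fun b => all (fun c => all (fun d => all (fun e => all (fun f =>
    [|| Z.eqb (a + b + c) 0, Z.eqb (d + e + f) 0,
        ~~ Z.eqb (Z.modulo (a * d + b * e + c * f) 3) 0
      | has (fun p => flag_eqb p.1 [:: a; b; c; d; e; f]) flag_seq])%Z F3) F3) F3) F3) F3) F3.
Proof. by vm_compute. Qed.

Opaque flag_seq.

Lemma residue_bound z : (0 <= residue z < 3)%Z.
Proof. exact: Z.mod_pos_bound. Qed.

Lemma flag_eqbP A B : flag_eqb (flag A) (flag B) <->
  [/\ inP (m11 A - m11 B), inP (m21 A - m21 B) & inP (m31 A - m31 B)] /\
  [/\ inP (m31 (madj A) - m31 (madj B)), inP (m32 (madj A) - m32 (madj B))
    & inP (m33 (madj A) - m33 (madj B))].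
Proof.
rewrite /flag_eqb /flag /=; split.
  case/and5P=> /Z.eqb_spec/residueP ? /Z.eqb_spec/residueP ? /Z.eqb_spec/residueP ?
    /Z.eqb_spec/residueP ?.
  by case/and3P=> /Z.eqb_spec/residueP ? /Z.eqb_spec/residueP ? _.
by case=> -[? ? ?] [? ? ?]; apply/and5P; split; [..|apply/and3P; split] => //;
  apply/Z.eqb_spec/residueP.
Qed.

Ltac inP_tac := do ![by [] | by apply: inP_mull | by apply: inP_mulr
  | apply: inP_add | apply: inP_sub | apply: inP_opp].

Lemma upper_adj A : upper A -> upper (madj A).
Proof.
case=> -[h1 h2 h3] [h4 h5 h6]; rewrite /upper /madj; cbn [m11 m22 m33 m21 m31 m32].
split; split; [..|inP_tac|inP_tac|inP_tac].
- have -> : m22 A * m33 A - m23 A * m32 A - 1 = (m22 A - 1) * m33 A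
  + (m33 A - 1) - m23 A * m32 A by ring.
  inP_tac.
- have -> : m11 A * m33 A - m13 A * m31 A - 1 = (m11 A - 1) * m33 A
  + (m33 A - 1) - m13 A * m31 A by ring.
  inP_tac.
- have -> : m11 A * m22 A - m12 A * m21 A - 1 = (m11 A - 1) * m22 A
  + (m22 A - 1) - m12 A * m21 A by ring.
  inP_tac.
Qed.

(** Modulo p, a unitriangular U fixes the first basis vector and its inverse fixes the last
    coordinate form. *)
Lemma upper_flag A B : mdet A = e1 -> upper (madj A * B)%mat -> flag_eqb (flag A) (flag B).
Proof.
move=> dA; set U := (madj A * B)%mat => uU.
have -> : B = (A * U)%mat by rewrite /U mmulA mulV // mmul1.
apply/flag_eqbP; rewrite madjM; have [[h1 h2 h3] [h4 h5 h6]] := uU.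
have [[k1 k2 k3] [k4 k5 k6]] := upper_adj uU; move: (madj U) (madj A) k1 k2 k3 k4 k5 k6
  => V C k1 k2 k3 k4 k5 k6.
rewrite /mmul; cbn [m11 m21 m31 m32 m33]; split; split.
- have -> : m11 A - (m11 A * m11 U + m12 A * m21 U + m13 A * m31 U) =
    - (m11 A * (m11 U - 1) + m12 A * m21 U + m13 A * m31 U) by ring.
  inP_tac.
- have -> : m21 A - (m21 A * m11 U + m22 A * m21 U + m23 A * m31 U) =
    - (m21 A * (m11 U - 1) + m22 A * m21 U + m23 A * m31 U) by ring.
  inP_tac.
- have -> : m31 A - (m31 A * m11 U + m32 A * m21 U + m33 A * m31 U) =
    - (m31 A * (m11 U - 1) + m32 A * m21 U + m33 A * m31 U) by ring.
  inP_tac.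
- have -> : m31 C - (m31 V * m11 C + m32 V * m21 C + m33 V * m31 C) =
    - (m31 V * m11 C + m32 V * m21 C + (m33 V - 1) * m31 C) by ring.
  inP_tac.
- have -> : m32 C - (m31 V * m12 C + m32 V * m22 C + m33 V * m32 C) =
    - (m31 V * m12 C + m32 V * m22 C + (m33 V - 1) * m32 C) by ring.
  inP_tac.
- have -> : m33 C - (m31 V * m13 C + m32 V * m23 C + m33 V * m33 C) =
    - (m31 V * m13 C + m32 V * m23 C + (m33 V - 1) * m33 C) by ring.
  inP_tac.
Qed.

(** The first column of A^-1 B is compared with that of A^-1 A, and its last row with that of B^-1
    B. The entry 22 then follows from the determinant. *)
Lemma flag_upper A B : mdet A = e1 -> mdet B = e1 -> flag_eqb (flag A) (flag B)
  -> upper (madj A * B)%mat.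
Proof.
move=> dA dB /flag_eqbP[[h1 h2 h3] [h4 h5 h6]].
have eB := mulVl dB; have eA := mulVl dA; have dU : mdet (madj A * B)%mat = e1.
  by rewrite mdetM mdet_adj dA dB; ring.
set C := madj A in h4 h5 h6 dU eA *; set D := madj B in h4 h5 h6 eB *.
have [a11 a21] := (f_equal m11 eA, f_equal m21 eA).
have [[b31 b32] b33] := (f_equal m31 eB, f_equal m32 eB, f_equal m33 eB).
cbn [m11 m21 m31 m32 m33 mmul mone] in a11, a21, b31, b32, b33.
have u11 : inP (m11 (C * B)%mat - 1).
  rewrite -a11; cbn [m11 mmul].
  have -> : m11 C * m11 B + m12 C * m21 B + m13 C * m31 B -
      (m11 C * m11 A + m12 C * m21 A + m13 C * m31 A) =
    - (m11 C * (m11 A - m11 B) + m12 C * (m21 A - m21 B) + m13 C * (m31 A - m31 B)) by ring.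
  inP_tac.
have u21 : inP (m21 (C * B)%mat).
  have -> : m21 (C * B)%mat = m21 (C * B)%mat - 0 by ring.
  rewrite -a21; cbn [m21 mmul].
  have -> : m21 C * m11 B + m22 C * m21 B + m23 C * m31 B -
      (m21 C * m11 A + m22 C * m21 A + m23 C * m31 A) =
    - (m21 C * (m11 A - m11 B) + m22 C * (m21 A - m21 B) + m23 C * (m31 A - m31 B)) by ring.
  inP_tac.
have u31 : inP (m31 (C * B)%mat).
  have -> : m31 (C * B)%mat = m31 (C * B)%mat - 0 by ring.
  rewrite -b31; cbn [m31 mmul].
  have -> : m31 C * m11 B + m32 C * m21 B + m33 C * m31 B -
      (m31 D * m11 B + m32 D * m21 B + m33 D * m31 B) =
    (m31 C - m31 D) * m11 B + (m32 C - m32 D) * m21 B + (m33 C - m33 D) * m31 B by ring.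
  inP_tac.
have u32 : inP (m32 (C * B)%mat).
  have -> : m32 (C * B)%mat = m32 (C * B)%mat - 0 by ring.
  rewrite -b32; cbn [m32 mmul].
  have -> : m31 C * m12 B + m32 C * m22 B + m33 C * m32 B -
      (m31 D * m12 B + m32 D * m22 B + m33 D * m32 B) =
    (m31 C - m31 D) * m12 B + (m32 C - m32 D) * m22 B + (m33 C - m33 D) * m32 B by ring.
  inP_tac.
have u33 : inP (m33 (C * B)%mat - 1).
  rewrite -b33; cbn [m33 mmul].
  have -> : m31 C * m13 B + m32 C * m23 B + m33 C * m33 B -
      (m31 D * m13 B + m32 D * m23 B + m33 D * m33 B) =
    (m31 C - m31 D) * m13 B + (m32 C - m32 D) * m23 B + (m33 C - m33 D) * m33 B by ring.
  inP_tac.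
split; split=> //; move: u11 u21 u31 u32 u33 dU; case: (C * B)%mat => a b c d e f g h i.
rewrite /mdet; cbn [m11 m12 m13 m21 m22 m23 m31 m32 m33] => u11 u21 u31 u32 u33 dU.
have -> : e - 1 = - ((a - 1) * (e * i) + e * (i - 1) - a * f * h - (b * i * d - b * f * g)
  + (c * h * d - c * e * g)).
  by rewrite -[in LHS]dU; ring.
inP_tac.
Qed.

Definition krep (k : nat) := nth 0 [:: 0; 1; - (1)] k.
Definition flag_rep n := nth ([::], mone) flag_seq n.

Lemma flag_repP n : n < 208 ->
  flag_eqb (flag (flag_rep n).2) (flag_rep n).1 /\ mdet (flag_rep n).2 = e1.
Proof.
have /andP[/andP[/eqP sz /all_nthP H] _] := flag_seq_ok.
move=> hn; have := H ([::], mone) n; rewrite sz => /(_ hn).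
rewrite /flag_rep; move: (nth _ _ _) => p hp.
by have [h1 h2] := andP hp; split; [exact: h1|exact: eeqbP h2].
Qed.

(** The quotient of [n] by 3 selects a coset of I through its flag; the remainder selects one of
    E12(0), E12(1), E12(-1), on which the form separates the three cosets of H in I. *)
Definition coset_rep (n : nat) := ((flag_rep (n %/ 3)).2 * E12 (krep (n %% 3)))%mat.

Lemma coset_rep_det n : n < 624 -> mdet (coset_rep n) = e1.
Proof.
move=> hn; rewrite mdetM (flag_repP _).2; last by rewrite ltn_divLR.
by rewrite /E12; mat_unfold; ring.
Qed.

Lemma flag_eqb_eq c d : flag_eqb c d -> c = d.
Proof.
elim: c d => [|a c IH] [|b d] //= /andP[/Z.eqb_spec -> /IH ->] //.
Qed.

Lemma upper_E12 x : upper (E12 x).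
Proof. by split; split; rewrite /E12 /=; exists 0; ring. Qed.

Lemma adj_E12 x : madj (E12 x) = E12 (- x).
Proof. elem_ring. Qed.

Lemma krep_inj j k : j < 3 -> k < 3 -> inP (krep k - krep j) -> j = k.
Proof.
by case: j => [|[|[|]]] //; case: k => [|[|[|]]] // _ _ /inPP; vm_compute.
Qed.

Lemma flag_eqb_refl c : flag_eqb c c.
Proof. by rewrite /flag_eqb; elim: c => //= a c ->; rewrite Z.eqb_refl. Qed.

Lemma pairwise_flag_inj (s : seq (seq Z * mat)) p0 m n :
  pairwise (fun p q => ~~ flag_eqb p.1 q.1) s -> m < size s -> n < size s ->
  (nth p0 s m).1 = (nth p0 s n).1 -> m = n.
Proof.
move=> /(pairwiseP p0) pw hm hn e.
case: (ltngtP m n) => // h; first by have := pw m n hm hn h; rewrite e flag_eqb_refl.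
by have := pw n m hn hm h; rewrite e flag_eqb_refl.
Qed.

Lemma flag_rep_inj m n : m < 208 -> n < 208 ->
  flag_eqb (flag (flag_rep m).2) (flag (flag_rep n).2) -> m = n.
Proof.
move=> hm hn /flag_eqb_eq e.
have [/flag_eqb_eq em _] := flag_repP hm; have [/flag_eqb_eq en _] := flag_repP hn.
have {e em en} e : (flag_rep m).1 = (flag_rep n).1 by rewrite -em e en.
have /andP[/andP[/eqP sz _] pw] := flag_seq_ok.
by apply: (pairwise_flag_inj pw _ _ e); rewrite sz.
Qed.

Lemma coset_rep_inj m n : m < 624 -> n < 624 ->
  pattern (madj (coset_rep m) * coset_rep n)%mat -> m = n.
Proof.
move=> hm hn; rewrite /coset_rep.
have [m3 n3] : m %/ 3 < 208 /\ n %/ 3 < 208 by rewrite !ltn_divLR.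
have [_ dm] := flag_repP m3; have [_ dn] := flag_repP n3; have inj := flag_rep_inj m3 n3.
have : m %/ 3 = n %/ 3 -> (flag_rep (m %/ 3)).2 = (flag_rep (n %/ 3)).2 by move=> ->.
move: (flag_rep (m %/ 3)).2 (flag_rep (n %/ 3)).2 dm dn inj => P Q dP dQ inj ePQ.
rewrite madjM adj_E12; set x := krep (m %% 3); set y := krep (n %% 3); set U := (madj P * Q)%mat.
have -> : (E12 (- x) * madj P * (Q * E12 y) = E12 (- x) * U * E12 y)%mat by rewrite /U !mmulA.
case=> up tf.
have E12V z : (E12 z * E12 (- z))%mat = mone by elem_ring.
have uU : upper U.
  have := upperM (upperM (upper_E12 x) up) (upper_E12 (- y)).
  by rewrite !mmulA E12V mmul1 -mmulA E12V mmulr1.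
have epq : m %/ 3 = n %/ 3 by apply: inj; apply: upper_flag.
have U1 : U = mone by rewrite /U (ePQ epq) mulVl.
rewrite U1 mmulr1 in tf.
have ek : m %% 3 = n %% 3.
  apply: krep_inj; rewrite ?ltn_mod // -/x -/y.
  move: tf; rewrite /trace_form /E12 /mmul; cbn [m11 m12 m13 m21 m22 m23 m31 m32 m33].
  case=> t ht; exists t.
  (* The form of E12(y - x) is [epi * (y - x)]; cancelling [epi] in its membership in p^2 leaves y -
     x in p. *)
  have e : epi * (y - x - epi * t) = 0.
    have -> : epi * (y - x - epi * t) = epi * (y - x) - epi * epi * t by ring.
    by rewrite -ht; ring.
  case: (eis_mul_eq0 e) => // e'.
  by have -> : y - x = (y - x - epi * t) + epi * t; [ring|rewrite e'; ring].
by rewrite (divn_eq m 3) (divn_eq n 3) epq ek.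
Qed.

Lemma all_residue (p : Z -> bool) z : all p F3 -> p (residue z).
Proof.
case/and4P=> p0 p1 p2 _.
have [->|[->|->]] : (residue z = 0 \/ residue z = 1 \/ residue z
  = 2)%Z by have := residue_bound z; lia.
all: by [].
Qed.

Lemma residue_lift z : inP (z - Eis (residue z) 0).
Proof.
apply/residueP; rewrite {2}/residue; cbn [ere eim].
by rewrite Z.add_0_r Z.mod_small //; apply: residue_bound.
Qed.

Lemma residue0 z : residue z = 0%Z -> inP z.
Proof.
move=> h; have -> : z = z - 0 by ring.
by apply/residueP; rewrite h.
Qed.

(** A unimodular triple is nonzero modulo p, and residues are nonnegative, so their sum vanishes
    only if they all do. *)
Lemma sum_residue_neq0 x y z x' y' z' : x' * x + y' * y + z' * z = 1 ->
  Z.eqb (residue x + residue y + residue z) 0 = false.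
Proof.
move=> e; apply/Z.eqb_neq => h.
have [/residue0 hx /residue0 hy] : residue x = 0%Z /\ residue y = 0%Z.
  by have := residue_bound x; have := residue_bound y; have := residue_bound z; lia.
have /residue0 hz : residue z = 0%Z.
  by have := residue_bound x; have := residue_bound y; have := residue_bound z; lia.
have /inPP : inP 1 by rewrite -e; inP_tac.
by [].
Qed.

(** From A^-1 A = A A^-1 = 1, the first column of A and the last row of A^-1 are unimodular, and
    their product is the entry 31 of the identity; so the flag is among those enumerated. *)
Lemma flag_full A : mdet A = e1 -> exists2 n, n < 208 & flag_eqb (flag (flag_rep n).2) (flag A).
Proof.
move=> dA; have eA := mulVl dA.
have := flag_seq_full.
move=> /(all_residue (m11 A)) /(all_residue (m21 A)) /(all_residue (m31 A)).
move=> /(all_residue (m31 (madj A))) /(all_residue (m32 (madj A))) /(all_residue (m33 (madj A))).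
rewrite (@sum_residue_neq0 _ _ _ (m11 (madj A)) (m12 (madj A)) (m13 (madj A)));
  last exact: (f_equal m11 eA).
rewrite (@sum_residue_neq0 _ _ _ (m13 A) (m23 A) (m33 A)); last first.
  by apply: etrans (f_equal m33 eA); cbn [m33 mmul]; ring.
have -> : Z.eqb (Z.modulo (residue (m11 A) * residue (m31 (madj A))
  + residue (m21 A) * residue (m32 (madj A)) + residue (m31 A) * residue (m33 (madj A))) 3) 0
  = true.
  have e31 : m31 (madj A) * m11 A + m32 (madj A) * m21 A + m33 (madj A) * m31 A
    = 0 := f_equal m31 eA.
  have : inP (Eis (residue (m11 A)) 0 * Eis (residue (m31 (madj A))) 0 +
    Eis (residue (m21 A)) 0 * Eis (residue (m32 (madj A))) 0 +
    Eis (residue (m31 A)) 0 * Eis (residue (m33 (madj A))) 0 -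
    (m31 (madj A) * m11 A + m32 (madj A) * m21 A + m33 (madj A) * m31 A)).
    have key x y : inP (Eis (residue x) 0 * Eis (residue y) 0 - y * x).
      have -> : Eis (residue x) 0 * Eis (residue y) 0 - y * x =
        - ((x - Eis (residue x) 0) * y) - Eis (residue x) 0 * (y - Eis (residue y) 0) by ring.
      by apply: inP_sub; [apply: inP_opp; apply: inP_mull|apply: inP_mulr]; apply: residue_lift.
    have := inP_add (inP_add (key (m11 A) (m31 (madj A))) (key (m21 A) (m32 (madj A))))
      (key (m31 A) (m33 (madj A))).
    by congr inP; ring.
  rewrite e31 => /inPP; rewrite /inPb /esub /eadd /emul; cbn [ere eim e0].
  by apply: etrans; congr (Z.eqb (Z.modulo _ _) _); ring.
cbn [negb orb] => /(has_nthP ([::], mone))[n].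
have /andP[/andP[/eqP -> _] _] := flag_seq_ok => hn h; exists n => //.
have [/flag_eqb_eq -> _] := flag_repP hn; exact: h.
Qed.

Lemma coset_rep_full A : mdet A = e1 -> exists2 n, n < 624 & pattern (madj (coset_rep n) * A)%mat.
Proof.
move=> dA; have [n hn hf] := flag_full dA; have [_ dn] := flag_repP hn.
have uU := flag_upper dn dA hf; set U := (_ * A)%mat in uU.
have [y hy] : inP (trace_form U).
  by case: uU => _ [_ h31 _]; apply: inP_add => //; exists (m12 U + m23 U).
(* The residue e of the form divided by [epi] decides which E12(e) has to be removed to bring the
   form into p^2. *)
have [e [z [he ey]]] := eis_mod_pi y.
have [k hk ek] : exists2 k, k < 3 & krep k = e.
  by case: he => ->; [exists 0%N|exists 1%N|exists 2%N].
have m3k : (n * 3 + k) %/ 3 = n by rewrite divnMDl // divn_small ?addn0.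
have r3k : (n * 3 + k) %% 3 = k by rewrite modnMDl modn_small.
exists (n * 3 + k)%N.
  by rewrite (@leq_trans (n * 3 + 3)) ?ltn_add2l // -mulSnr (@leq_mul n.+1 3 208 3).
rewrite /coset_rep m3k r3k ek madjM adj_E12 -mmulA -/U.
split; first exact: upperM (upper_E12 _) uU.
have [t ht ->] := trace_formM (upper_E12 (- e)) uU.
apply: inP2_add ht; exists z; rewrite hy ey /trace_form /E12; cbn [m31 m12 m23].
ring.
Qed.

End Flags.

(** * Reduction modulo powers of 1 - w *)

Section Reduction.
Local Open Scope eis_scope.

(* The norm of such a [z] would be a cube root of [9]. *)
Lemma cube_neq_pi2 z : z * (z * z) <> epi * epi.
Proof.
move/(f_equal enorm); rewrite !enormM; have := @enorm_ge0 z; move: (enorm z) => n n0 h.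
have {h} h : (n * (n * n) = 9)%Z by rewrite h.
have [h3|h3] : (n <= 2 \/ 3 <= n)%Z by lia.
  have : (n = 0 \/ n = 1 \/ n = 2)%Z by lia.
  by case=> [e|[e|e]]; rewrite e in h.
by nia.
Qed.

Definition msub A B := Mat
  (m11 A - m11 B) (m12 A - m12 B) (m13 A - m13 B)
  (m21 A - m21 B) (m22 A - m22 B) (m23 A - m23 B)
  (m31 A - m31 B) (m32 A - m32 B) (m33 A - m33 B).
Definition madd A B := Mat
  (m11 A + m11 B) (m12 A + m12 B) (m13 A + m13 B)
  (m21 A + m21 B) (m22 A + m22 B) (m23 A + m23 B)
  (m31 A + m31 B) (m32 A + m32 B) (m33 A + m33 B).

Lemma madd_msub A B : madd A (msub B A) = B.
Proof. by mat_destruct; rewrite /madd /msub; mat_unfold; f_equal; ring. Qed.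
Lemma msub_madd A B : msub (madd A B) A = B.
Proof. by mat_destruct; rewrite /madd /msub; mat_unfold; f_equal; ring. Qed.

Definition mall (I : eis -> Prop) A :=
  [/\ [/\ I (m11 A), I (m12 A) & I (m13 A)],
      [/\ I (m21 A), I (m22 A) & I (m23 A)]
    & [/\ I (m31 A), I (m32 A) & I (m33 A)]].

Lemma mallP c A : mall (fun z => exists y, z = c * y) A <-> exists B, A = mscale c B.
Proof.
split=> [[[[a ha] [b hb] [d hd]] [[e he] [f hf] [g hg]] [[h hh] [i hi] [j hj]]]|[B ->]].
  exists (Mat a b d e f g h i j); case: A ha hb hd he hf hg hh hi hj => *.
  by rewrite /mscale; congr Mat.
by split; split; rewrite /mscale /=; eexists.
Qed.

Lemma mcongE n A : mcong (idl n) A <-> exists B, A = madd mone (mscale (epow n) B).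
Proof.
have -> : mcong (idl n) A <-> mall (idl n) (msub A mone).
  rewrite /mcong /mall /msub /mone; cbn [m11 m12 m13 m21 m22 m23 m31 m32 m33].
  have e z : z - 0 = z by ring.
  by rewrite !e.
rewrite mallP; split=> -[B hB]; exists B; last by rewrite hB; mat_destruct; rewrite /msub /madd;
  mat_unfold; f_equal; ring.
by rewrite -hB; mat_destruct; rewrite /msub /madd; mat_unfold; f_equal; ring.
Qed.

Lemma mul_mcong n A B : (exists C, B = madd mone (mscale (epow n) C)) ->
  exists C, (A * B)%mat = madd A (mscale (epow n) C).
Proof.
case=> C ->; exists (A * C)%mat; mat_destruct; rewrite /madd; mat_unfold; f_equal; ring.
Qed.

Lemma adj_mcong n A B : mdet A = e1 -> (exists C, B = madd A (mscale (epow n) C)) ->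
  exists C, (madj A * B)%mat = madd mone (mscale (epow n) C).
Proof.
move=> dA [C ->]; exists (madj A * C)%mat; rewrite -(mulVl dA).
by move: (madj A) => D; mat_destruct; rewrite /madd; mat_unfold; f_equal; ring.
Qed.

Definition mpi Y := madd mone (mscale epi Y).

Lemma mpiM Y Z : (mpi Y * mpi Z)%mat = mpi (madd (madd Y Z) (mscale epi (Y * Z)%mat)).
Proof. by mat_destruct; rewrite /mpi /madd; mat_unfold; f_equal; ring. Qed.

Lemma mpi_add Y C : madd (mpi Y) (mscale (epow 2) C) = mpi (madd Y (mscale epi C)).
Proof.
have -> : epow 2 = epi * epi by [].
by mat_destruct; rewrite /mpi /madd; mat_unfold; f_equal; ring.
Qed.

(** The determinant of 1 + [epi] Y is 1 + [epi] tr(Y) modulo p^2; one factor [epi] is cancelled. *)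
Lemma det_mpi Y : mdet (mpi Y) = e1 -> inP (m11 Y + m22 Y + m33 Y).
Proof.
case: Y => a b c d e f g h i; rewrite /mpi /madd; mat_unfold => dY.
exists (- (a * e + a * i + e * i - b * d - c * g - f * h +
  epi * (a * (e * i - f * h) - b * (d * i - f * g) + c * (d * h - e * g)))).
set z := - _.
have e0' : epi * (a + e + i - epi * z) = 0.
  have d0 := f_equal (fun t => t - 1) dY; cbv beta in d0.
  by apply: etrans (etrans _ d0) _; rewrite /z; ring.
case: (eis_mul_eq0 e0') => // h0.
have -> : a + e + i = (a + e + i - epi * z) + epi * z by ring.
by rewrite h0; ring.
Qed.

(** Here the form is [epi * m31 Y] modulo p^2: the condition on 12, 23 and 31 degenerates into one
    on the entry 31 alone. *)
Lemma pattern_mpi Y : pattern (mpi Y) -> inP (m31 Y).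
Proof.
case=> _ [z hz]; exists (z - (m12 Y + m23 Y)).
have e : epi * (m31 Y - epi * (z - (m12 Y + m23 Y))) = 0.
  move: hz; rewrite /trace_form /mpi /madd /mscale /mone; cbn [m31 m12 m23] => hz.
  have -> : 0 = epi * epi * z - epi * epi * z by ring.
  by rewrite -{1}hz; ring.
case: (eis_mul_eq0 e) => // h0.
have -> : m31 Y = (m31 Y - epi * (z - (m12 Y + m23 Y))) + epi * (z - (m12 Y + m23 Y)) by ring.
by rewrite h0; ring.
Qed.

Lemma scale_mpi Y : mscale ew (mpi Y) = mpi (msub (mscale ew Y) mone).
Proof. by mat_destruct; rewrite /mpi /madd /msub; mat_unfold; f_equal; ring. Qed.

(* Multiplication by the scalar [w = 1 - pi] shifts the diagonal of [Y] by [-1]. *)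
Lemma normalize_mpi (P : mat -> Prop) Y : (forall A, P A -> P (mscale ew A)) -> P (mpi Y) ->
  exists Z, P (mpi Z) /\ inP (m11 Z).
Proof.
move=> PS PY; have [e [y [he ey]]] := eis_mod_pi (m11 Y).
have P1 : P (mpi (msub (mscale ew Y) mone)) by rewrite -scale_mpi; apply: PS.
have P2 : P (mpi (msub (mscale ew (msub (mscale ew Y) mone)) mone)) by rewrite -scale_mpi;
  apply: PS.
case: he ey => -> ey.
- by exists Y; split=> //; exists y; rewrite ey; ring.
- by exists (msub (mscale ew Y) mone); split=> //; exists (ew * y - 1);
  cbn [m11 msub mscale mone]; rewrite ey; ring.
- exists (msub (mscale ew (msub (mscale ew Y) mone)) mone); split=> //.
  by exists (ew * ew * y); cbn [m11 msub mscale mone]; rewrite ey; ring.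
Qed.

(** The class of X modulo p is attained by an element 1 + [epi] Y of [Gen]. *)
Definition lift_sl3 X := exists2 Y, Gen (mpi Y) & exists C, Y = madd X (mscale epi C).

Lemma lift_sl3_add X Y : lift_sl3 X -> lift_sl3 Y -> lift_sl3 (madd X Y).
Proof.
move=> [X' gX [C eX]] [Y' gY [D eY]]; move: (GenM gX gY); rewrite mpiM eX eY.
set Z := madd (madd _ _) _ => gZ; exists Z => //; rewrite /Z.
exists (madd (madd C D) (madd X (mscale epi C) * madd Y (mscale epi D))%mat).
by clear; mat_destruct; rewrite /madd; mat_unfold; f_equal; ring.
Qed.

Lemma lift_sl3_Gen X : Gen (mpi X) -> lift_sl3 X.
Proof.
move=> g; exists X => //; exists (mscale 0 mone).
by mat_destruct; rewrite /madd; mat_unfold; f_equal; ring.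
Qed.

(* With [x = pi n], the diagonal direction is lifted by the matrix with lower right
   block [1 + x, x^2; - x^2, 1 - x + x^2 - x^3], of determinant [1]. *)
Lemma lift_sl3_diag x : lift_sl3 (Mat 0 0 0 0 x 0 0 0 (- x)).
Proof.
set Y := Mat 0 0 0 0 x (epi * x * x) 0 (- (epi * x * x)) (- x
  + epi * x * x - epi * epi * x * x * x).
exists Y; last first.
  exists (Mat 0 0 0 0 0 (x * x) 0 (- (x * x)) (x * x - epi * x * x * x)).
  by rewrite /Y /madd; mat_unfold; f_equal; ring.
apply/GenP; split; first by rewrite /Y /mpi /madd; mat_unfold; ring.
split; last first.
  by exists (epi * x * x); rewrite /trace_form /Y /mpi /madd /mscale; cbn [m31 m12 m23 mone];
    ring.
rewrite /upper /Y /mpi /madd; mat_unfold; split; split.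
- by exists 0; ring.
- by exists x; ring.
- by exists (- x + epi * x * x - epi * epi * x * x * x); ring.
- by exists 0; ring.
- by exists 0; ring.
- by exists (- (epi * x * x)); ring.
Qed.

Lemma lift_sl3_all a b c d e f : lift_sl3 (Mat 0 a b c d e 0 f (- d)).
Proof.
have -> : Mat 0 a b c d e 0 f (- d) = madd (Mat 0 0 0 0 d 0 0 0 (- d))
  (madd (Mat 0 a 0 0 0 0 0 0 0) (madd (Mat 0 0 b 0 0 0 0 0 0)
  (madd (Mat 0 0 0 c 0 0 0 0 0) (madd (Mat 0 0 0 0 0 e 0 0 0) (Mat 0 0 0 0 0 0 0 f 0))))).
  by rewrite /madd; mat_unfold; f_equal; ring.
apply: lift_sl3_add; first exact: lift_sl3_diag.
do !apply: lift_sl3_add; apply: lift_sl3_Gen.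
- by have := Gen_E12 a; congr Gen; rewrite /mpi /madd; elem_ring.
- by have := Gen_E13 (epi * b); congr Gen; rewrite /mpi /madd; elem_ring.
- by have := Gen_E21 c; congr Gen; rewrite /mpi /madd; elem_ring.
- by have := Gen_E23 e; congr Gen; rewrite /mpi /madd; elem_ring.
- by have := Gen_E32 f; congr Gen; rewrite /mpi /madd; elem_ring.
Qed.

Lemma mpi_mcong Y : mcong (idl 1) (mpi Y).
Proof. by apply/mcongE; exists Y. Qed.

Lemma mcong_mpi A : mcong (idl 1) A -> exists Y, A = mpi Y.
Proof. by move=> /mcongE[Y ->]; exists Y. Qed.

(* [E31] corrects the trace form without changing the reduction. *)
Lemma upper_lift a b c : Gen (upt a b c * E31 (- (epi * (a + c))))%mat.
Proof.
apply/GenP; split; first by rewrite /upt /E31; mat_unfold; ring.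
have uE : upper (E31 (- (epi * (a + c)))).
  by split; split; rewrite /E31; cbn [m11 m22 m33 m21 m31 m32];
    [exists 0; ring..|exists (- (a + c)); ring|exists 0; ring].
have uu := upper_upt a b c; split; first exact: upperM.
have [z hz ->] := trace_formM uu uE.
have -> : trace_form (upt a b c) + trace_form (E31 (- (epi * (a + c)))) + z = z; last by [].
by rewrite /trace_form /upt /E31; cbn [m31 m12 m23]; ring.
Qed.

End Reduction.

From mathcomp Require Import all_order all_algebra.
From mathcomp Require Import all_classical reals.
From mathcomp.real_closed Require Import complex.
From mathcomp Require Import ssrZ ring.

Import GRing.Theory.
Local Open Scope ring_scope.
Local Open Scope classical_set_scope.

(** * Matrices representing elements of PSL3 *)

Section Represents.
Variables (n : nat) (F : fieldType).
Implicit Types (A B : 'M[F]_n) (g h : PSL n F).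

Lemma representsM A B g h : represents A g -> represents B h -> represents (A *m B) (g * h)%g.
Proof. by move=> [S <- <-] [T <- <-]; exists (S * T)%g; rewrite ?PSL_ofM. Qed.

Lemma representsV A g : represents A g -> represents (invmx A) g^-1%g.
Proof. by move=> [S <- <-]; exists (S^-1)%g => //; rewrite -PSL_invE. Qed.

Lemma represents_det A g : represents A g -> \det A = 1.
Proof. by case=> S <- _; apply: det_SL. Qed.

Lemma represents_ex A : \det A = 1 -> exists g, represents A g.
Proof. by move=> /eqP d; exists (PSL_of (MkSL d)), (MkSL d). Qed.

Lemma represents_inj A g h : represents A g -> represents A h -> g = h.
Proof. by move=> [S <- <-] [T e <-]; congr PSL_of; apply: val_inj. Qed.

Lemma represents_scal A B g : represents A g -> represents B g -> exists c, B = c *: A.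
Proof. by move=> [S <- <-] [T <- /esym/PSL_ofP[c e]]; exists c. Qed.

Lemma represents_scale A g c : \det (c *: A) = 1 -> represents A g -> represents (c *: A) g.
Proof.
move=> /eqP d [S e <-]; exists (MkSL d) => //; apply/esym/PSL_ofP; exists c.
by rewrite e.
Qed.

Lemma represents1 : represents (1%:M : 'M[F]_n) 1%g.
Proof. by exists 1%g. Qed.

End Represents.

Section ThreeByThree.
Variable R : comNzRingType.

Definition M3 (a b c d e f g h i : R) : 'M[R]_3 := mx3 [:: [:: a; b; c]; [:: d; e; f]; [:: g; h;
  i]].

Definition i0 : 'I_3 := @Ordinal 3 0 isT.
Definition i1 : 'I_3 := @Ordinal 3 1 isT.
Definition i2 : 'I_3 := @Ordinal 3 2 isT.

Lemma I3P (P : 'I_3 -> Prop) : P i0 -> P i1 -> P i2 -> forall i, P i.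
Proof.
move=> p0 p1 p2 [[|[|[|//]]] hi].
- by rewrite (_ : Ordinal hi = i0) //; apply: val_inj.
- by rewrite (_ : Ordinal hi = i1) //; apply: val_inj.
- by rewrite (_ : Ordinal hi = i2) //; apply: val_inj.
Qed.

Lemma sum3 (V : nmodType) (f : 'I_3 -> V) : \sum_i f i = f i0 + f i1 + f i2.
Proof.
rewrite !big_ord_recl big_ord0 addr0 addrA.
by congr (f _ + f _ + f _); apply: val_inj.
Qed.

Lemma M3_eta (A : 'M[R]_3) :
  A = M3 (A i0 i0) (A i0 i1) (A i0 i2) (A i1 i0) (A i1 i1) (A i1 i2) (A i2 i0) (A i2 i1) (A i2
    i2).
Proof. by apply/matrixP; apply: I3P; apply: I3P; rewrite mxE. Qed.

Lemma M3_inj a b c d e f g h i a' b' c' d' e' f' g' h' i' :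
  M3 a b c d e f g h i = M3 a' b' c' d' e' f' g' h' i' ->
  [/\ [/\ a = a', b = b' & c = c'], [/\ d = d', e = e' & f = f']
    & [/\ g = g', h = h' & i = i']].
Proof.
move/matrixP => eq.
move: (eq i0 i0) (eq i0 i1) (eq i0 i2) (eq i1 i0) (eq i1 i1) (eq i1 i2) (eq i2 i0) (eq i2 i1)
  (eq i2 i2).
by rewrite !mxE.
Qed.

Lemma M3_mul a b c d e f g h i a' b' c' d' e' f' g' h' i' :
  M3 a b c d e f g h i *m M3 a' b' c' d' e' f' g' h' i' =
  M3 (a * a' + b * d' + c * g') (a * b' + b * e' + c * h') (a * c' + b * f' + c * i')
     (d * a' + e * d' + f * g') (d * b' + e * e' + f * h') (d * c' + e * f' + f * i')
     (g * a' + h * d' + i * g') (g * b' + h * e' + i * h') (g * c' + h * f' + i * i').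
Proof. by apply/matrixP; apply: I3P; apply: I3P; rewrite !mxE sum3 !mxE. Qed.

Lemma M3_scale x a b c d e f g h i :
  x *: M3 a b c d e f g h i =
  M3 (x * a) (x * b) (x * c) (x * d) (x * e) (x * f) (x * g) (x * h) (x * i).
Proof. by apply/matrixP; apply: I3P; apply: I3P; rewrite !mxE. Qed.

Lemma M3_one : 1%:M = M3 1 0 0 0 1 0 0 0 1.
Proof. by apply/matrixP; apply: I3P; apply: I3P; rewrite !mxE. Qed.

Lemma M3_det a b c d e f g h i :
  \det (M3 a b c d e f g h i) =
  a * (e * i - f * h) - b * (d * i - f * g) + c * (d * h - e * g).
Proof.
rewrite (expand_det_row _ i0) sum3 /cofactor.
rewrite !(expand_det_row _ ord0) !big_ord_recl !big_ord0 /cofactor !det_mx11 !mxE /=.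
rewrite /bump /=; ring.
Qed.

End ThreeByThree.

(** * The map from Z[w] to a field with a root of x^2 + x + 1 *)

Section Embedding.
Variables (F : fieldType) (w : F).
Hypotheses (char0 : injective (intr : int -> F)) (hw : w ^+ 2 = - w - 1).

Definition zemb (z : eis) : F := (int_of_Z (ere z))%:~R + (int_of_Z (eim z))%:~R * w.

Lemma zembD x y : zemb (eadd x y) = zemb x + zemb y.
Proof.
rewrite /zemb /eadd /= (rmorphD int_of_Z (ere x) (ere y)) (rmorphD int_of_Z (eim x) (eim y))
  !rmorphD /=.
ring.
Qed.

Lemma zembN x : zemb (eopp x) = - zemb x.
Proof.
rewrite /zemb /eopp /= (rmorphN int_of_Z (ere x)) (rmorphN int_of_Z (eim x)) !rmorphN /=.
ring.
Qed.

Lemma zembB x y : zemb (esub x y) = zemb x - zemb y.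
Proof. by rewrite -zembN -zembD. Qed.

Lemma zembM x y : zemb (emul x y) = zemb x * zemb y.
Proof.
rewrite /zemb /emul /=.
case: x y => a b [c d] /=.
have ZB p q : int_of_Z (Z.sub p q) = int_of_Z p - int_of_Z q by exact: (rmorphB int_of_Z p q).
have ZA p q : int_of_Z (Z.add p q) = int_of_Z p + int_of_Z q by exact: (rmorphD int_of_Z p q).
have ZM p q : int_of_Z (Z.mul p q) = int_of_Z p * int_of_Z q by exact: (rmorphM int_of_Z p q).
rewrite !(ZB, ZA, ZM) !(rmorphB, rmorphD, rmorphM) /=.
ring: hw.
Qed.

Lemma zemb0 : zemb e0 = 0. Proof. by rewrite /zemb /= !mulr0z mul0r addr0. Qed.
Lemma zemb1 : zemb e1 = 1. Proof. by rewrite /zemb /= !mulr0z mul0r addr0. Qed.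
Lemma zembw : zemb ew = w. Proof. by rewrite /zemb /= mul1r add0r. Qed.
Lemma zemb_pi : zemb epi = 1 - w. Proof. by rewrite /zemb /= mulN1r. Qed.

(** Multiplication by the conjugate reduces this to an integer, the norm. *)
Lemma zemb_eq0 z : zemb z = 0 -> z = e0.
Proof.
move=> h; have : zemb (emul z (econj z)) = 0 by rewrite zembM h mul0r.
rewrite emul_conj /zemb /= mulr0z mul0r addr0 -(mulr0z 1) => /char0 /(congr1 Z_of_int).
by rewrite int_of_ZK; apply: enorm_eq0.
Qed.

Lemma zemb_inj : injective zemb.
Proof.
move=> x y /eqP; rewrite -subr_eq0 -zembB => /eqP/zemb_eq0.
case: x y => a b [c d] [h1 h2]; congr Eis; lia.
Qed.

Definition emb A : 'M[F]_3 :=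
  M3 (zemb (m11 A)) (zemb (m12 A)) (zemb (m13 A))
     (zemb (m21 A)) (zemb (m22 A)) (zemb (m23 A))
     (zemb (m31 A)) (zemb (m32 A)) (zemb (m33 A)).

Lemma embM A B : emb (mmul A B) = emb A *m emb B.
Proof. by rewrite /emb M3_mul /mmul /= !(zembD, zembM). Qed.

Lemma emb1 : emb mone = 1%:M.
Proof. by rewrite M3_one /emb /= zemb0 zemb1. Qed.

Lemma emb_scale c A : emb (mscale c A) = zemb c *: emb A.
Proof. by rewrite /emb M3_scale /= !zembM. Qed.

Lemma emb_det A : \det (emb A) = zemb (mdet A).
Proof. by rewrite /emb M3_det /mdet !(zembD, zembB, zembM). Qed.

Lemma emb_inj : injective emb.
Proof.
move=> [a b c d f g h i j] [a' b' c' d' f' g' h' i' j'].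
rewrite /emb; cbn [m11 m12 m13 m21 m22 m23 m31 m32 m33].
case/M3_inj=> -[/zemb_inj -> /zemb_inj -> /zemb_inj ->].
case=> /zemb_inj -> /zemb_inj -> /zemb_inj ->.
by case=> /zemb_inj -> /zemb_inj -> /zemb_inj ->.
Qed.

End Embedding.

(** * Representatives over Z[w] and the congruence subgroups *)

Section Congruence.
Variables (F : fieldType) (w r : F).
Hypotheses (char0 : injective (intr : int -> F)) (hw : w ^+ 2 = - w - 1) (hr : r ^+ 3 = 1 - w).

Lemma three_neq0 : 3%:R != 0 :> F.
Proof.
apply/eqP => h; have : (3%:Z)%:~R = (0%:Z)%:~R :> F by rewrite mulr0z -h.
by move/char0.
Qed.

Ltac pi_mx := rewrite /emb ?M3_mul /emb /zemb /= /Pos.to_nat /=; congr M3;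
  first [by field: hw hr; rewrite ?three_neq0 | by ring: hw hr].

Lemma pi_a_det : \det (pi_a w r) = 1.
Proof. by rewrite M3_det; field: hw hr; exact: three_neq0. Qed.

Lemma pi_b_a : pi_b w r *m pi_a w r = emb w gm0.
Proof. pi_mx. Qed.

Lemma pi_aaa : pi_a w r *m pi_a w r *m pi_a w r = emb w gm3.
Proof. pi_mx. Qed.

Lemma pi_m0_a : emb w gm0 *m pi_a w r = pi_a w r *m emb w gm1.
Proof. pi_mx. Qed.

Lemma pi_m1_a : emb w gm1 *m pi_a w r = pi_a w r *m emb w gm2.
Proof. pi_mx. Qed.

Lemma pi_b_det : \det (pi_b w r) = 1.
Proof.
have := congr1 determinant pi_b_a.
by rewrite det_mulmx pi_a_det mulr1 emb_det // => ->; rewrite zemb1.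
Qed.

Lemma w3 : w ^+ 3 = 1.
Proof. by ring: hw. Qed.

Lemma cube_root1 c : c ^+ 3 = 1 -> [\/ c = 1, c = w | c = w ^+ 2].
Proof.
move=> hc; have : (c - 1) * ((c - w) * (c - w ^+ 2)) = 0 by ring: hw hc.
move/eqP; rewrite !mulf_eq0 !subr_eq0 => /or3P[] /eqP; first by constructor 1.
- by constructor 2.
- by constructor 3.
Qed.

Lemma Zadj_zemb x : Zadj w x <-> exists z, x = zemb w z.
Proof.
split=> [[p ->]|[[a b] ->]].
  elim/poly_ind: p => [|p c [z hz]].
    by exists e0; rewrite map_poly0 horner0 zemb0.
  exists (eadd (emul z ew) (Eis (Z_of_int c) Z0)).
  rewrite rmorphD rmorphM /= map_polyX map_polyC /= hornerMXaddC hz.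
  by rewrite zembD zembM // zembw [zemb w (Eis _ _)]/zemb /= Z_of_intK mulr0z mul0r addr0.
exists ((int_of_Z a)%:P + (int_of_Z b)%:P * 'X).
by rewrite rmorphD rmorphM /= !map_polyC map_polyX /= hornerD hornerM !hornerC hornerX.
Qed.

Definition repm A g := represents (emb w A) (g : PSL 3 F).

Lemma rep_det A g : repm A g -> mdet A = e1.
Proof.
by move/represents_det; rewrite emb_det // -(zemb1 w) => /(zemb_inj char0 hw).
Qed.

Lemma rep_ex A : mdet A = e1 -> exists g, repm A g.
Proof. by move=> d; apply: represents_ex; rewrite emb_det // d zemb1. Qed.

Lemma repM A B g h : repm A g -> repm B h -> repm (mmul A B) (g * h)%g.
Proof. by rewrite /repm embM //; apply: representsM. Qed.

Lemma rep1 : repm mone 1%g.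
Proof. by rewrite /repm emb1; apply: represents1. Qed.

Lemma repV A g : repm A g -> repm (madj A) g^-1%g.
Proof.
move=> h; have d := rep_det h; have := representsV h; rewrite /repm.
suff -> : emb w (madj A) = invmx (emb w A) by [].
have u : emb w A \in unitmx by rewrite unitmxE emb_det // d zemb1 unitr1.
by rewrite -[LHS](mulKmx u) -embM // mulV // emb1 mulmx1.
Qed.

Lemma rep_w A g : repm A g -> repm (mscale ew A) g.
Proof.
move=> h; have d := rep_det h; rewrite /repm emb_scale // zembw; apply: represents_scale h.
by rewrite detZ w3 mul1r emb_det // d zemb1.
Qed.

(** Both determinants are 1, so the scalar between the two matrices has cube 1 and is a power of w.
    Hence every representative of such an element has its entries in O. *)
Lemma rep_emb A g B : repm A g -> represents B g ->
  [\/ B = emb w A, B = emb w (mscale ew A) | B = emb w (mscale ew (mscale ew A))].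
Proof.
move=> h hB; have [c e] := represents_scal h hB.
have : c ^+ 3 = 1.
  by have := represents_det hB; rewrite e detZ (represents_det h) mulr1.
rewrite !emb_scale // zembw scalerA -expr2.
case/cube_root1 => ec; rewrite ec in e.
- by constructor 1; rewrite e scale1r.
- by constructor 2.
- by constructor 3.
Qed.

Lemma rep_scal A B g : repm A g -> repm B g ->
  [\/ B = A, B = mscale ew A | B = mscale ew (mscale ew A)].
Proof.
move=> hA hB; case: (rep_emb hA hB) => /(emb_inj char0 hw);
  by [constructor 1|constructor 2|constructor 3].
Qed.

Lemma zemb_pow n : zemb w (epow n) = (1 - w) ^+ n.
Proof.
elim: n => [|n IH]; first by rewrite zemb1.
by rewrite /epow iterS zembM // zemb_pi -/(epow n) IH exprS.
Qed.

Lemma principal_zemb n z : principal (Zadj w) ((1 - w) ^+ n) (zemb w z) <-> idl n z.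
Proof.
split=> [[x /Zadj_zemb[y ->]]|[y ->]].
  by rewrite -zemb_pow -zembM // => /(zemb_inj char0 hw) <-; exists y.
by exists (zemb w y); [apply/Zadj_zemb; exists y|rewrite zembM // zemb_pow].
Qed.

Lemma K_rep n g : K w n g <-> exists2 A, repm A g & mcong (idl n) A.
Proof.
split=> [[A [hA O I]]|[A hA [[h1 h2 h3] [h4 h5 h6] [h7 h8 h9]]]].
  have ex i j : exists z, A i j = zemb w z by apply/Zadj_zemb.
  pose f i j := sval (cid (ex i j)).
  have hf i j : A i j = zemb w (f i j) by exact: svalP (cid (ex i j)).
  pose B := Mat (f i0 i0) (f i0 i1) (f i0 i2) (f i1 i0) (f i1 i1) (f i1 i2) (f i2 i0) (f i2 i1)
    (f i2 i2).
  have eA : A = emb w B by rewrite [A]M3_eta !hf.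
  exists B; first by rewrite /repm -eA.
  have off i j : i != j -> idl n (f i j).
    by move=> ne; apply/principal_zemb; have := I i j; rewrite (negbTE ne) subr0 hf.
  have dia i : idl n (esub (f i i) e1).
    by apply/principal_zemb; have := I i i; rewrite eqxx hf zembB zemb1.
  by split; split; apply: off || apply: dia.
have dia z : idl n (esub z e1) -> principal (Zadj w) ((1 - w) ^+ n) (zemb w z - 1).
  by move=> /principal_zemb; rewrite zembB zemb1.
have off z : idl n z -> principal (Zadj w) ((1 - w) ^+ n) (zemb w z - 0).
  by move=> hz; rewrite subr0; apply/principal_zemb.
exists (emb w A); split=> //.
  by apply: I3P; apply: I3P; rewrite !mxE /=; apply/Zadj_zemb; eexists.
by apply: I3P; apply: I3P; rewrite !mxE /=; apply: off || apply: dia.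
Qed.

Lemma K0_rep g : K w 0 g <-> exists A, repm A g.
Proof.
split=> [/K_rep[A hA _]|[A hA]]; first by exists A.
by apply/K_rep; exists A => //; split; split; apply: idl0.
Qed.

Lemma K_sub_K0 n : K w n `<=` K w 0.
Proof. by move=> g /K_rep[A rA _]; apply/K0_rep; exists A. Qed.

End Congruence.

(** * The representation and its image *)

Section MultiplicativeMaps.
Variables (G H : groupType) (f : {multiplicative G -> H}).

Lemma mult1 : f 1%g = 1%g.
Proof. by apply: (mulgI (f 1%g)); rewrite -gmulfM !mulg1. Qed.

Lemma multV x : f x^-1%g = (f x)^-1%g.
Proof. by apply: (mulgI (f x)); rewrite -gmulfM !mulgV mult1. Qed.

Lemma multX x n : f (x ^+ n)%g = (f x ^+ n)%g.
Proof. by elim: n => [|n IH]; rewrite ?expg0 ?mult1 // !expgS gmulfM IH. Qed.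

End MultiplicativeMaps.

Section Image.
Variables (F : fieldType) (w r : F).
Hypotheses (char0 : injective (intr : int -> F)) (hw : w ^+ 2 = - w - 1) (hr : r ^+ 3 = 1 - w).
Local Notation rep := (repm w).

Lemma rep_eq A g h : rep A g -> rep A h -> g = h.
Proof. exact: represents_inj. Qed.

Section Generators.
Variables (ga gb : PSL 3 F).
Hypotheses (ra : represents (pi_a w r) ga) (rb : represents (pi_b w r) gb).

Lemma rep_ba : rep gm0 (gb * ga)%g.
Proof. by rewrite /repm -(pi_b_a char0 hw hr); apply: representsM. Qed.

Lemma rep_aaa : rep gm3 (ga * ga * ga)%g.
Proof. by rewrite /repm -(pi_aaa char0 hw hr); do !apply: representsM. Qed.

(** The matrix of a is not over O; the relation A a = a B gives the conjugate without inverting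
    it. *)
Lemma rep_conj_a A B g : emb w A *m pi_a w r = pi_a w r *m emb w B -> mdet B = e1 ->
  rep A g -> rep B (ga^-1 * g * ga)%g.
Proof.
move=> e dB rA; have [h rBh] := rep_ex hw dB.
suff -> : (ga^-1 * g * ga = h)%g by [].
have eq : (g * ga = ga * h)%g.
  by apply: represents_inj (representsM rA ra) _; rewrite e; apply: representsM.
by rewrite -mulgA eq mulKg.
Qed.

Lemma rep_m1 : rep gm1 (ga^-1 * (gb * ga) * ga)%g.
Proof. exact: rep_conj_a (pi_m0_a char0 hw hr) _ rep_ba. Qed.

Lemma rep_m2 : rep gm2 (ga^-1 * (ga^-1 * (gb * ga) * ga) * ga)%g.
Proof. exact: rep_conj_a (pi_m1_a char0 hw hr) _ rep_m1. Qed.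

End Generators.

Section Existence.
Variables (ga gb : PSL 3 F).
Hypotheses (ra : represents (pi_a w r) ga) (rb : represents (pi_b w r) gb).
Let f (x : bool) := if x then ga else gb.

Lemma weval_winv (v : word bool) : weval f (winv v) = (weval f v)^-1%g.
Proof.
apply: (mulgI (weval f v)); rewrite mulgV -weval_cat.
by rewrite (weval_pres (rels := [::]) _ (pres_catV [::] v)) // /weval big_nil.
Qed.

Lemma rep_scalar1 g : rep (mscale ew (mscale ew mone)) g -> g = 1%g.
Proof. by move=> h; apply: rep_eq h _; do 2!apply: rep_w => //; apply: rep1. Qed.

Lemma pi_rels u : u \in Gamma_rels -> weval f u = 1%g.
Proof.
have r0 := rep_ba ra rb; have r1 := rep_m1 ra rb; have r3 := rep_aaa ra.
set x := word_a ++ winv word_b ++ word_a; set y := word_b ++ word_a.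
have wy : weval f y = (gb * ga)%g by rewrite /weval !big_cons big_nil mulg1.
(* Writing a b^-1 a = a^3 (a^-1 (b a) a)^-1 turns the relators into words in matrices over O. *)
have wx : weval f x = (ga * ga * ga * (ga^-1 * (gb * ga) * ga)^-1)%g.
  rewrite /weval !big_cons big_nil mulg1 /=.
  by rewrite !invgM !invgK !mulgA !mulgK.
have rx := repM hw r3 (repV char0 hw r1); rewrite -wx in rx; rewrite -wy in r0.
have wexp3 v : wexp v 3 = (v ++ v ++ v : word bool) by rewrite /wexp /= cats0.
rewrite !inE -/x -/y {wx wy}; clearbody x y => /or3P[] /eqP ->.
- rewrite wexp3 !weval_cat.
  apply: rep_eq (repM hw r0 (repM hw r0 r0)) _.
  by have := rep1 w; congr (repm _ _ _); apply: meqbP.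
- rewrite wexp3 !weval_cat.
  apply: rep_eq (repM hw rx (repM hw rx rx)) _.
  by have := rep1 w; congr (repm _ _ _); apply: meqbP.
(* On matrices the commutator is the scalar w^2, so this relation holds only modulo scalars. *)
rewrite /wcomm !weval_cat !weval_winv; apply: rep_scalar1.
have := repM hw r0 (repM hw rx (repM hw (repV char0 hw r0) (repV char0 hw rx))).
by congr (repm _ _ _); apply: meqbP.
Qed.

End Existence.

Lemma pi_exists : exists pi : {multiplicative Gamma -> PSL 3 F},
  represents (pi_a w r) (pi gen_a) /\ represents (pi_b w r) (pi gen_b).
Proof.
have [ga ra] := represents_ex (pi_a_det char0 hw hr).
have [gb rb] := represents_ex (pi_b_det char0 hw hr).
exists (pres_lift (pi_rels ra rb)).
by rewrite /gen_a /gen_b /= !pres_liftE /weval !big_seq1.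
Qed.

Section Range.
Variable pi : {multiplicative Gamma -> PSL 3 F}.
Hypotheses (ra : represents (pi_a w r) (pi gen_a)) (rb : represents (pi_b w r) (pi gen_b)).
Let ga := pi gen_a.
Let gb := pi gen_b.

Definition Img (g : PSL 3 F) := exists2 A, Gen A & rep A g.

Lemma Img1 : Img 1%g.
Proof. by exists mone; [apply: Gen1|apply: rep1]. Qed.

Lemma ImgM g h : Img g -> Img h -> Img (g * h)%g.
Proof.
by move=> [A gA rA] [B gB rB]; exists (mmul A B); [apply: GenM|apply: repM].
Qed.

Lemma ImgV g : Img g -> Img g^-1%g.
Proof. by move=> [A gA rA]; exists (madj A); [apply: Gen_adj|apply: repV]. Qed.

Definition pi_ba := (gb * ga)%g.
Definition pi_ba_a := (ga^-1 * pi_ba * ga)%g.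
Definition pi_ba_aa := (ga^-1 * pi_ba_a * ga)%g.
Definition pi_a3 := (ga * ga * ga)%g.

Lemma Img_pi : [/\ Img pi_ba, Img pi_ba_a, Img pi_ba_aa & Img pi_a3].
Proof.
split.
- by exists gm0; [apply: (Gen_letter 0)|apply: rep_ba].
- by exists gm1; [apply: (Gen_letter 1)|apply: rep_m1].
- by exists gm2; [apply: (Gen_letter 2)|apply: rep_m2].
- by exists gm3; [apply: (Gen_letter 3)|apply: rep_aaa].
Qed.

(** The power of a and that of [sigma] share the exponent k, so a single induction on words controls
    [pi x] and [mu x] together. *)
Definition in_cosets (g : PSL 3 F) (m : 'Z_3) :=
  exists2 k, (k < 3)%N & exists2 h, Img h & g = (ga ^+ k * h)%g /\ m = (sigma ^+ k)%g.

Lemma in_cosets_a g m : in_cosets g m -> in_cosets (ga * g)%g (sigma * m)%g.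
Proof.
have [_ _ _ I3] := Img_pi.
move=> [[|[|[|//]]] _ [h Ih [-> ->]]].
- by exists 1%N => //; exists h => //; rewrite expg0 mul1g expg1 mulg1.
- by exists 2%N => //; exists h => //; rewrite mulgA -!expgS.
- exists 0%N => //; exists (pi_a3 * h)%g; first exact: ImgM.
  by rewrite expg0 mul1g mulgA; split; [rewrite /pi_a3 expgS expg1 mulgA|apply/val_inj].
Qed.

Lemma in_cosets_aV g m : in_cosets g m -> in_cosets (ga^-1 * g)%g (sigma^-1 * m)%g.
Proof.
have [_ _ _ I3] := Img_pi.
move=> [[|[|[|//]]] _ [h Ih [-> ->]]].
- exists 2%N => //; exists (pi_a3^-1 * h)%g; first exact/ImgM/Ih/ImgV.
  split; last exact/val_inj.
  by rewrite expg0 mul1g mulgA /pi_a3 !invgM !mulgA mulgK mulgV mul1g.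
- by exists 0%N => //; exists h => //; rewrite expg1 mulKg mulVg expg0 mul1g.
- by exists 1%N => //; exists h => //; rewrite !expg2 !expg1 -!mulgA !mulKg.
Qed.

Let conjK (x y : PSL 3 F) : (x * (x^-1 * y * x) = y * x)%g.
Proof. by rewrite -mulgA mulVKg. Qed.

(** Moving b a to the right past a^k replaces it by its conjugate by a^k, which is still in the
    image for k < 3. *)
Lemma in_cosets_h g m : in_cosets g m
  -> in_cosets (pi_ba * g)%g m /\ in_cosets (pi_ba^-1 * g)%g m.
Proof.
have [I0 I1 I2 _] := Img_pi.
have e1 : (pi_ba * ga = ga * pi_ba_a)%g by rewrite conjK.
have e2 : (pi_ba_a * ga = ga * pi_ba_aa)%g by rewrite conjK.
move: pi_ba pi_ba_a pi_ba_aa I0 I1 I2 e1 e2 => k0 k1 k2 I0 I1 I2 e1 e2.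
have [e1' e2'] : (k0^-1 * ga = ga * k1^-1)%g /\ (k1^-1 * ga = ga * k2^-1)%g.
  by split; apply: (canLR (mulKg _)); rewrite mulgA ?e1 ?e2 mulgK.
move=> [[|[|[|//]]] lk [h Ih [-> ->]]]; split; rewrite ?expg0 ?expg1 ?expg2 ?mul1g.
- by exists 0%N => //; exists (k0 * h)%g; [exact: ImgM|rewrite expg0 mul1g].
- by exists 0%N => //; exists (k0^-1 * h)%g; [exact/ImgM/Ih/ImgV|rewrite expg0 mul1g].
- by exists 1%N => //; exists (k1 * h)%g; [exact: ImgM|rewrite expg1 !mulgA e1].
- by exists 1%N => //; exists (k1^-1 * h)%g; [exact/ImgM/Ih/ImgV|rewrite expg1 !mulgA e1'].
- exists 2%N => //; exists (k2 * h)%g; first exact: ImgM.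
  by rewrite !expg2 !mulgA e1 -(mulgA ga) e2 !mulgA.
- exists 2%N => //; exists (k2^-1 * h)%g; first exact/ImgM/Ih/ImgV.
  by rewrite !expg2 !mulgA e1' -(mulgA ga) e2' !mulgA.
Qed.

Lemma pi_in_cosets x : in_cosets (pi x) (mu x).
Proof.
have [u ->] := pres_ofK x; elim: u => [|[l e] u IH].
  rewrite (_ : pres_of _ [::] = (1 : Gamma)%g) // !mult1.
  by exists 0%N => //; exists 1%g; [apply: Img1|rewrite expg0 mulg1].
rewrite -[_ :: u]/([:: (l, e)] ++ u) pres_ofM !gmulfM.
have pV v : pres_of Gamma_rels (winv v) = ((pres_of Gamma_rels v)^-1)%g.
  by rewrite -pres_invE.
have mb : mu gen_b = (sigma^-1)%g by rewrite mu_b; apply/val_inj.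
(* As b = (b a) a^-1, words in a and b become words in a and b a, and b a has trivial image under
   [mu]. *)
have eb : gb = (pi_ba * ga^-1)%g by rewrite /pi_ba mulgK.
case: l; case: e.
- by rewrite -/word_a -/gen_a mu_a; apply: in_cosets_a.
- rewrite (pV word_a) !multV -/gen_a mu_a; exact: in_cosets_aV.
- rewrite -/word_b -/gen_b mb -/gb eb -mulgA.
  by case: (in_cosets_h (in_cosets_aV IH)).
- rewrite (pV word_b) !multV -/gen_b mb invgK -/gb eb invgM invgK -mulgA.
  by apply: in_cosets_a; case: (in_cosets_h IH).
Qed.

Lemma Img_Gamma0 g : Img g <-> (pi @` Gamma0) g.
Proof.
split=> [[A gA rA]|[x mx <-]].
  suff [x mx rx] : exists2 x, mu x = 1%g & rep A (pi x).
    by exists x => //; apply: rep_eq rx rA.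
  move: A gA {rA}; apply: Gen_ind => [|k A [x mx rx]].
    by exists 1%g; rewrite mult1 //; apply: rep1.
  suff [y my ry] : exists2 y, mu y = 1%g & rep (letter k) (pi y).
    by exists (y * x)%g; rewrite gmulfM ?my ?mx ?mulg1 //; apply: repM.
  have lift A' (y : Gamma) : mu y = 1%g -> rep A' (pi y) -> 
      (exists2 y, mu y = 1%g & rep A' (pi y)) /\ (exists2 y, mu y = 1%g & rep (madj A') (pi y)).
    move=> my ry; split; first by exists y.
    by exists (y^-1)%g; rewrite multV ?my ?invg1 //; apply: repV.
  have m0 : mu (gen_b * gen_a)%g = 1%g by rewrite gmulfM mu_a mu_b; apply/val_inj.
  have m1 y : mu y = 1%g -> mu (gen_a^-1 * y * gen_a)%g = 1%g.
    by move=> my; rewrite !gmulfM multV my mu_a; apply/val_inj.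
  have [l0 l4] := lift gm0 (gen_b * gen_a)%g m0 ltac:(rewrite gmulfM; apply: rep_ba => //).
  have [l1 l5] := lift gm1 _ (m1 _ m0) ltac:(rewrite !(gmulfM, multV); apply: rep_m1 => //).
  have [l2 l6] := lift gm2 _ (m1 _ (m1 _ m0)) ltac:(rewrite !(gmulfM, multV); apply: rep_m2
    => //).
  have [l3 l7] := lift gm3 (gen_a * gen_a * gen_a)%g ltac:(rewrite !gmulfM mu_a; apply/val_inj
    => //) ltac:(rewrite !gmulfM; apply: rep_aaa => //).
  case: k => [|[|[|[|[|[|[|[|[|k]]]]]]]]] //.
    by exists 1%g; rewrite mult1 //; exact: (rep_w char0 hw (rep1 w)).
  have -> : letter k.+1.+4.+4 = mone by rewrite /letter nth_default.
  by exists 1%g; rewrite mult1 //; apply: rep1.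
have [[|[|[|//]]] _ [h Ih [-> e]]] := pi_in_cosets x.
- by rewrite expg0 mul1g.
- by move: mx; rewrite /Gamma0 /= e => /(congr1 val).
- by move: mx; rewrite /Gamma0 /= e => /(congr1 val).
Qed.

End Range.
End Image.

(** * Indices and cosets *)

Section Cosets.
Variable G : groupType.
Implicit Types H K : set G.

Definition is_subgroup H :=
  [/\ H 1%g, forall g h, H g -> H h -> H (g * h)%g & forall g, H g -> H g^-1%g].

Lemma lcoset_eq H g h : is_subgroup H -> H (g^-1 * h)%g -> lcoset g H = lcoset h H.
Proof.
case=> H1 HM HV gh; apply/seteqP; split=> _ [k Hk <-] /=.
  by exists ((g^-1 * h)^-1 * k)%g; [apply/HM/Hk/HV|rewrite invgM invgK -!mulgA !mulVKg].
by exists (g^-1 * h * k)%g; [apply: HM|rewrite -!mulgA mulVKg].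
Qed.

Lemma lcoset_eqV H g h : is_subgroup H -> lcoset g H = lcoset h H -> H (g^-1 * h)%g.
Proof.
case=> H1 HM HV e; have : lcoset h H h by exists 1%g; rewrite ?mulg1.
by rewrite -e => -[k Hk <-]; rewrite mulKg.
Qed.

Lemma has_indexP K H m (f : nat -> G) : is_subgroup H ->
  (forall i, (i < m)%N -> K (f i)) ->
  (forall i j, (i < m)%N -> (j < m)%N -> H ((f i)^-1 * f j)%g -> i = j) ->
  (forall g, K g -> exists2 i, (i < m)%N & H ((f i)^-1 * g)%g) ->
  has_index K H m.
Proof.
move=> sH fK finj ffull; rewrite /has_index.
have -> : lcosets K H = (fun i => lcoset (f i) H) @` `I_m.
  apply/seteqP; split=> _ [x Kx <-].
    by have [i im Hi] := ffull x Kx; exists i => //; apply: lcoset_eq.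
  by exists (f x) => //; apply: fK.
apply: inj_card_eq => i j; rewrite !inE /= => im jm e.
by apply: finj => //; apply: lcoset_eqV.
Qed.

Lemma has_index_finite K H m : has_index K H m -> finite_set (lcosets K H).
Proof. by move=> h; apply/finite_setP; exists m. Qed.

End Cosets.

Section RangeOfPi.
Variables (F : fieldType) (w r : F).
Hypotheses (char0 : injective (intr : int -> F)) (hw : w ^+ 2 = - w - 1) (hr : r ^+ 3 = 1 - w).
Variable pi : {multiplicative Gamma -> PSL 3 F}.
Hypotheses (ra : represents (pi_a w r) (pi gen_a)) (rb : represents (pi_b w r) (pi gen_b)).
Local Notation rep := (repm w).
Local Notation Im := (Img w).
Let ga := pi gen_a.

Lemma Img_subgroup : is_subgroup Im.
Proof. by split; [apply: Img1|move=> *; apply: ImgM|move=> *; apply: ImgV]. Qed.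

Lemma Img_K0 g : Im g -> K w 0 g.
Proof. by case=> A _ rA; apply/(K0_rep char0 hw); exists A. Qed.

Lemma r2_notin z : r ^+ 2 <> zemb w z.
Proof.
move=> e; apply: (@cube_neq_pi2 z); apply: (zemb_inj char0 hw).
by rewrite !zembM // -e zemb_pi; ring: hr.
Qed.

Lemma ga_notin_K0 : ~ K w 0 ga.
Proof.
move=> /(K0_rep char0 hw) [A rA].
have [B eB] : exists B, pi_a w r = emb w B.
  by case: (rep_emb hw rA ra) => ->; eexists.
(* The entry 33 of the matrix of a is r^2. *)
apply: (@r2_notin (m33 B)); have /matrixP/(_ i2 i2) := eB.
by rewrite !mxE.
Qed.

Lemma K0_subgroup : is_subgroup (K w 0).
Proof.
split=> [|g h|g]; rewrite !(K0_rep char0 hw).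
- by exists mone; apply: rep1.
- by move=> [A rA] [B rB]; exists (mmul A B); apply: repM => //.
- by move=> [A rA]; exists (madj A); apply: repV => //.
Qed.

(** If a^2 were in K_0, then so would be a = a^-2 a^3, because a^3 is. *)
Lemma ga_pow_notin k : (0 < k < 3)%N -> ~ K w 0 (ga ^+ k)%g.
Proof.
have [K1 KM KV] := K0_subgroup.
case: k => [|[|[|//]]] // _; first by rewrite expg1; apply: ga_notin_K0.
move=> h2; apply: ga_notin_K0.
have h3K : K w 0 (ga * ga * ga)%g.
  by apply/(K0_rep char0 hw); exists gm3; apply: (rep_aaa char0 hw hr ra).
have -> : ga = ((ga ^+ 2)^-1 * (ga * ga * ga))%g by rewrite expg2 invgM -!mulgA !mulKg.
by apply: KM => //; apply: KV.
Qed.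

Lemma range_K0 : range pi `&` K w 0 = Im.
Proof.
have [K1 KM KV] := K0_subgroup.
apply/seteqP; split=> g /=; last first.
  move=> Ig; split; last exact: Img_K0.
  by move/(Img_Gamma0 char0 hw hr ra rb): Ig => [x _ <-]; exists x.
case=> -[x _ <-]; have [k k3 [h Ih [-> _]]] := pi_in_cosets char0 hw hr ra rb x.
case: k k3 => [|k] k3; first by rewrite expg0 mul1g.
move=> Kx; case: (@ga_pow_notin k.+1); first by rewrite k3.
have -> : (ga ^+ k.+1 = ga ^+ k.+1 * h * h^-1)%g by rewrite mulgK.
by apply: KM => //; apply: KV; apply: Img_K0.
Qed.

Lemma range_index : has_index (range pi) Im 3.
Proof.
have [K1 KM KV] := K0_subgroup.
apply: (@has_indexP _ _ _ _ (fun i => ga ^+ i)%g); first exact: Img_subgroup.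
- by move=> i _; exists (gen_a ^+ i)%g => //; rewrite multX.
- have key i k : (i + k.+1 < 3)%N -> ~ K w 0 ((ga ^+ i)^-1 * ga ^+ (i + k.+1))%g.
    move=> h; rewrite expgnDr mulKg; apply: ga_pow_notin => /=.
    by apply: leq_ltn_trans h; apply: leq_addl.
  move=> i j i3 j3 /Img_K0 h; case: (ltngtP i j) => // ij.
    by case: (@key i (j - i.+1)%N); rewrite addnS -addSn subnKC.
  case: (@key j (i - j.+1)%N); rewrite addnS -addSn subnKC //.
  by have := KV _ h; rewrite invgM invgK.
- move=> _ [x _ <-]; have [k k3 [h Ih [-> _]]] := pi_in_cosets char0 hw hr ra rb x.
  by exists k => //; rewrite mulKg.
Qed.

Lemma K0_index : has_index (K w 0) Im 624.
Proof.
have ex n : exists g, (n < 624)%N -> rep (coset_rep n) g.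
  case: (ltnP n 624) => h; last by exists 1%g.
  by have [g hg] := rep_ex hw (coset_rep_det h); exists g.
have [f hf] := choice ex.
apply: (@has_indexP _ _ _ _ f); first exact: Img_subgroup.
- by move=> i h; apply/(K0_rep char0 hw); exists (coset_rep i); apply: hf.
- move=> i j hi hj [A gA rA]; apply: (coset_rep_inj hi hj).
  have rB := repM hw (repV char0 hw (hf _ hi)) (hf _ hj).
  suff : Gen (mmul (madj (coset_rep i)) (coset_rep j)) by case/GenP.
  by case: (rep_scal char0 hw rA rB) => ->; do ?apply: Gen_scale.
- move=> g /(K0_rep char0 hw) [A rA].
  have [n hn pn] := coset_rep_full (rep_det char0 hw rA).
  exists n => //; exists (mmul (madj (coset_rep n)) A).
    apply/GenP; split=> //; rewrite mdetM mdet_adj coset_rep_det // (rep_det char0 hw rA).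
    by [].
  by apply: repM => //; apply: repV => //; apply: hf.
Qed.

Lemma K2_Img g : K w 2 g -> Im g.
Proof.
move=> /(K_rep char0 hw) [A rA]; rewrite /mcong.
have I2 z : idl 2 z -> inP z by move/idl2/inP2_P.
case=> -[h1 h2 h3] [h4 h5 h6] [h7 h8 h9]; exists A => //; apply/GenP; split;
  first exact: rep_det rA.
split; first by split; split; apply: I2.
rewrite /trace_form; apply: inP2_add; first exact/idl2.
by apply: inP2_pi; apply: inP_add; apply: I2.
Qed.

End RangeOfPi.

(** * The quotients K_0/K_1 and K_1/K_2 *)

Section ReductionModP.
Variables (F : fieldType) (w r : F).
Hypotheses (char0 : injective (intr : int -> F)) (hw : w ^+ 2 = - w - 1) (hr : r ^+ 3 = 1 - w).
Local Notation rep := (repm w).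
Local Notation Im := (Img w).

(* Reduction modulo [1 - w] is the embedding of [Z[w]] in [F_3] sending [w] to [1]. *)
Local Notation red := (zemb (1 : 'F_3)).
Local Notation redm := (emb (1 : 'F_3)).

Lemma F3_w : (1 : 'F_3) ^+ 2 = - 1 - 1.
Proof. by apply/val_inj. Qed.

Lemma red_inP z : inP z <-> red z = 0.
Proof.
split=> [[y ->]|]; first by rewrite (zembM F3_w) zemb_pi subrr mul0r.
have [e [y [he ->]]] := eis_mod_pi z.
rewrite zembD (zembM F3_w) zemb_pi subrr mul0r addr0.
case: he => ->.
- by move=> _; exists y; apply: (zemb_inj char0 hw); rewrite zembD zemb0 add0r.
- by rewrite zemb1 => /(congr1 val).
- by rewrite zembN zemb1 => /(congr1 val).
Qed.

Lemma red_eq x y : inP (esub x y) <-> red x = red y.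
Proof.
rewrite red_inP zembB; split=> [/eqP|->]; last by rewrite subrr.
by rewrite subr_eq0 => /eqP.
Qed.

Lemma zemb_nat (F' : fieldType) (w' : F') n : zemb w' (Eis (Z.of_nat n) Z0) = n%:R.
Proof.
rewrite /zemb /= mulr0z mul0r addr0; have -> : int_of_Z (Z.of_nat n) = n%:Z by lia.
by rewrite pmulrn.
Qed.

Lemma red_nat (c : 'F_3) : red (Eis (Z.of_nat c) Z0) = c.
Proof. by rewrite zemb_nat natr_Zp. Qed.

Lemma reduces_zemb z c : reduces w (zemb w z) c <-> red z = c.
Proof.
rewrite /reduces -(zemb_nat w) -zembB -[1 - w]expr1 (principal_zemb char0 hw) idl1 red_eq.
by rewrite red_nat.
Qed.

Lemma reduces_Zadj x c : reduces w x c -> exists z, x = zemb w z.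
Proof.
case=> y /(Zadj_zemb hw)[z ->] e; exists (eadd (emul epi z) (Eis (Z.of_nat c) Z0)).
by rewrite zembD (zembM hw) zemb_pi e zemb_nat subrK.
Qed.

Lemma reduces_emb A B : reduces_mx w (emb w A) B <-> redm A = B.
Proof.
split=> [h|<-].
  by apply/matrixP; apply: I3P; apply: I3P; rewrite mxE /=; apply/reduces_zemb;
    (have := h i0 i0; have := h i0 i1; have := h i0 i2; have := h i1 i0; have := h i1 i1;
     have := h i1 i2; have := h i2 i0; have := h i2 i1; have := h i2 i2; rewrite !mxE).
by apply: I3P; apply: I3P; rewrite !mxE /=; apply/reduces_zemb.
Qed.

Lemma matrix_emb (A : 'M[F]_3) : (forall i j, exists z, A i j = zemb w z) -> exists B,
  A = emb w B.
Proof.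
move=> ex; pose f i j := sval (cid (ex i j)).
have hf i j : A i j = zemb w (f i j) by exact: svalP (cid (ex i j)).
exists (Mat (f i0 i0) (f i0 i1) (f i0 i2) (f i1 i0) (f i1 i1) (f i1 i2) (f i2 i0) (f i2 i1) (f i2
  i2)).
by rewrite [A]M3_eta !hf.
Qed.

Lemma redm_eq A B : redm A = redm B <-> exists C, B = madd A (mscale epi C).
Proof.
have -> : redm A = redm B <-> mall inP (msub B A).
  split=> [/M3_inj[[e11 e12 e13] [e21 e22 e23] [e31 e32 e33]]|].
    split; split; apply/red_eq; symmetry; [exact: e11|exact: e12|exact: e13|
      exact: e21|exact: e22|exact: e23|exact: e31|exact: e32|exact: e33].
  case=> -[/red_eq e11 /red_eq e12 /red_eq e13] [/red_eq e21 /red_eq e22 /red_eq e23]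
    [/red_eq e31 /red_eq e32 /red_eq e33].
  by rewrite /emb e11 e12 e13 e21 e22 e23 e31 e32 e33.
rewrite mallP; split=> -[C hC]; exists C.
  by rewrite -hC madd_msub.
by rewrite hC msub_madd.
Qed.

Lemma redmM A B : redm (mmul A B) = redm A *m redm B.
Proof. exact: embM F3_w _ _. Qed.

Lemma F3_cube (c : 'F_3) : c ^+ 3 = c.
Proof. by apply/eqP; move: c; case=> [[|[|[|//]]] i]; apply/eqP/val_inj. Qed.

(* Scalars of determinant [1] are trivial over [F_3]. *)
Lemma represents_F3_inj (A B : 'M['F_3]_3) x : represents A x -> represents B x -> A = B.
Proof.
move=> rA rB; have [c e] := represents_scal rA rB.
have := represents_det rB; rewrite e detZ (represents_det rA) mulr1 F3_cube => ->.
by rewrite scale1r.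
Qed.

Lemma lcoset_rep n A g g' : rep A g ->
  lcoset g (K w n) g' <-> exists2 A', rep A' g' & exists C, A' = madd A (mscale (epow n) C).
Proof.
move=> rA; split=> [[h /(K_rep char0 hw)[B rB /mcongE cB] <-]|[A' rA' cA]].
  by exists (mmul A B); [apply: repM|apply: mul_mcong].
exists (g^-1 * g')%g; last by rewrite mulVKg.
apply/(K_rep char0 hw); exists (mmul (madj A) A').
  by apply: repM => //; apply: repV.
by apply/mcongE; apply: adj_mcong => //; apply: rep_det rA.
Qed.

Lemma lcoset_coset01 A g x : rep A g -> represents (redm A) x -> lcoset g (K w 1) = coset01 w x.
Proof.
move=> rA rx; apply/seteqP; split=> g'.
  move=> /(lcoset_rep _ _ rA)[A' rA' cA].
  exists (emb w A'), (redm A'); split=> //; first exact/reduces_emb.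
  by have <- : redm A = redm A' by apply/redm_eq; case: cA => C ->; exists C.
case=> A'' [B [rA'' hred rB]].
have [A' eA'] : exists A', A'' = emb w A'.
  by apply: matrix_emb => i j; apply: reduces_Zadj (hred i j).
rewrite eA' in rA'' hred; move/reduces_emb in hred.
apply/(lcoset_rep _ _ rA); exists A' => //.
by apply/redm_eq; rewrite hred; apply: represents_F3_inj rx rB.
Qed.

Lemma emb_mpi (F' : fieldType) (w' : F') Y : w' ^+ 2 = - w' - 1 ->
  emb w' (mpi Y) = 1%:M + (1 - w') *: emb w' Y.
Proof.
move=> hw'; apply/matrixP; apply: I3P; apply: I3P;
  by rewrite !mxE /mpi /madd /= zembD (zembM hw') zemb_pi ?zemb0 ?zemb1.
Qed.

Lemma lcoset_coset12 Y g : rep (mpi Y) g -> lcoset g (K w 2) = coset12 w (redm Y).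
Proof.
move=> rA; apply/seteqP; split=> g'.
  move=> /(lcoset_rep _ _ rA)[A' rA' [C eA']].
  have eA : A' = mpi (madd Y (mscale epi C)) by rewrite eA' mpi_add.
  exists (emb w (madd Y (mscale epi C))); last by rewrite -emb_mpi // -eA.
  by apply/reduces_emb/esym/redm_eq; exists C.
case=> Y'' hred rY''.
have [Y' eY'] : exists Y', Y'' = emb w Y'.
  by apply: matrix_emb => i j; apply: reduces_Zadj (hred i j).
rewrite eY' -emb_mpi // in rY'' hred; move/reduces_emb in hred.
have /redm_eq[C eC] := esym hred.
by apply/(lcoset_rep _ _ rA); exists (mpi Y') => //; exists C; rewrite eC mpi_add.
Qed.

Lemma Uplus_redm A x : upper A -> represents (redm A) x -> Uplus x.
Proof.
case=> -[h11 h22 h33] [/red_inP h21 /red_inP h31 /red_inP h32] rx; exists (redm A) => //.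
have {h11 h22 h33} [h11 h22 h33] : [/\ red (m11 A) = 1, red (m22 A) = 1 & red (m33 A) = 1].
  by move: h11 h22 h33 => /red_eq -> /red_eq -> /red_eq ->; rewrite zemb1.
by apply: I3P; apply: I3P; rewrite ?mxE //= => _; rewrite ?h11 ?h22 ?h33 ?h21 ?h31 ?h32.
Qed.

Lemma lcosets01 : lcosets Im (K w 1) = coset01 w @` Uplus.
Proof.
apply/seteqP; split=> C.
  case=> g [A gA rA] <-; have [dA [uA _]] := (GenP A).1 gA.
  have [x rx] : exists x, represents (redm A) x.
    by apply: represents_ex; rewrite (emb_det F3_w) dA zemb1.
  by exists x; [apply: Uplus_redm rx|rewrite (lcoset_coset01 rA rx)].
case=> x [B rB hB] <-.
pose l (c : 'F_3) := Eis (Z.of_nat c) Z0.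
have gA := upper_lift (l (B i0 i1)) (l (B i0 i2)) (l (B i1 i2)).
set A := mmul _ _ in gA; have [g rA] := rep_ex hw (Gen_det gA).
exists g; first by exists A.
have eA : redm A = B.
  rewrite /A redmM; have -> : redm (E31 (eopp (emul epi (eadd (l (B i0 i1)) (l (B i1 i2))))))
    = 1%:M.
    by rewrite M3_one /emb /E31 /= zembN (zembM F3_w) zemb_pi subrr mul0r oppr0 zemb0 zemb1.
  rewrite mulmx1 [RHS]M3_eta /emb /upt /= !red_nat zemb0 zemb1.
  by rewrite (hB i0 i0) // (hB i1 i0) // (hB i1 i1) // (hB i2 i0) // (hB i2 i1) // (hB i2 i2).
by apply: lcoset_coset01 rA _; rewrite eA.
Qed.

Lemma K1_Img g : (Im `&` K w 1) g <-> exists Y, [/\ Gen (mpi Y), rep (mpi Y) g & inP (m11 Y)].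
Proof.
split=> [[[A gA rA] /(K_rep char0 hw)[B rB /mcong_mpi[Y eY]]]|[Y [gY rY _]]].
  have gB : Gen B by case: (rep_scal char0 hw rA rB) => ->; do ?apply: Gen_scale.
  rewrite eY in rB gB.
  have [Z [[gZ rZ] h]] : exists Z, (Gen (mpi Z) /\ rep (mpi Z) g) /\ inP (m11 Z).
    apply: (@normalize_mpi (fun A => Gen A /\ rep A g) Y) => // C [gC rC].
    by split; [apply: Gen_scale|apply: rep_w].
  by exists Z.
by split; [exists (mpi Y)|apply/(K_rep char0 hw); exists (mpi Y) => //; apply: mpi_mcong].
Qed.

(** Three conditions cut out the subspace: the entry 11 is made zero by a power of the scalar w, the
    entry 31 vanishes by the form, and the trace vanishes by the determinant. *)
Lemma lcosets12 : lcosets (Im `&` K w 1) (K w 2) = coset12 w @` sl3_sub.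
Proof.
apply/seteqP; split=> C.
  case=> g /K1_Img[Y [gY rY h11]] <-; exists (redm Y); last by rewrite (lcoset_coset12 rY).
  have [dY pY] := (GenP _).1 gY; have /red_inP h31 := pattern_mpi pY.
  have /red_inP := det_mpi dY; move/red_inP: h11 => h11.
  rewrite !zembD h11 add0r => /eqP; rewrite addrC addr_eq0 => /eqP h33.
  exists (red (m12 Y)), (red (m13 Y)), (red (m21 Y)), (red (m22 Y)), (red (m23 Y)), (red (m32 Y)).
  by rewrite /emb h11 h31 h33.
case=> X [a [b [c [d [e [f ->]]]]]] <-.
pose l (c : 'F_3) := Eis (Z.of_nat c) Z0.
have [Y gY /redm_eq eY] := lift_sl3_all (l a) (l b) (l c) (l d) (l e) (l f).
have [g rg] := rep_ex hw (Gen_det gY).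
exists g.
  by split; [exists (mpi Y)|apply/(K_rep char0 hw); exists (mpi Y) => //; apply: mpi_mcong].
rewrite (lcoset_coset12 rg) -eY; congr (coset12 w _).
by rewrite /emb /= zembN !red_nat zemb0.
Qed.

End ReductionModP.

(** * Arithmeticity *)

Section Integers.
Variables (F : fieldType) (w r : F).
Hypotheses (char0 : injective (intr : int -> F)) (hw : w ^+ 2 = - w - 1) (hr : r ^+ 3 = 1 - w).
Local Notation iota := (zemb w).

(** The field Q(w) as the fractions of O inside the given field: arithmeticity is witnessed by Q(w),
    with ring of integers O. *)
Definition Qw : {pred F} := fun x => `[< exists z d, d <> e0 /\ x = iota z / iota d >].

Lemma zemb_neq0 d : d <> e0 -> iota d != 0.
Proof. by move=> h; apply/eqP => /(zemb_eq0 char0 hw). Qed.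

Lemma emul_neq0 x y : x <> e0 -> y <> e0 -> emul x y <> e0.
Proof. by move=> hx hy /eis_mul_eq0[]. Qed.

Lemma Qw_closed : divring_closed Qw.
Proof.
split.
- by apply/asboolP; exists e1, e1; split=> //; rewrite zemb1 divr1.
- move=> x y /asboolP[z [d [d0 ->]]] /asboolP[z' [d' [d0' ->]]]; apply/asboolP.
  exists (esub (emul z d') (emul z' d)), (emul d d'); split; first exact: emul_neq0.
  rewrite zembB !(zembM hw); field.
  by rewrite !zemb_neq0.
- move=> x y /asboolP[z [d [d0 ->]]] /asboolP[z' [d' [d0' ->]]]; apply/asboolP.
  have [e|ne] := pselect (z' = e0).
    by exists e0, e1; split=> //; rewrite e !zemb0 mul0r invr0 mulr0 mul0r.
  exists (emul z d'), (emul d z'); split; first exact: emul_neq0.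
  rewrite !(zembM hw); field.
  by rewrite !zemb_neq0.
Qed.

Lemma ratr_frac (a n : int) : n != 0 -> ratr (a%:~R / n%:~R) = a%:~R / n%:~R :> F.
Proof.
move=> n0; set q : rat := _ / _; rewrite /ratr.
have inj (m : int) : m != 0 -> m%:~R != 0 :> F.
  by move=> m0; apply/eqP => h; move/eqP: m0; apply; apply: char0; rewrite h mulr0z.
have e : numq q * n = a * denq q.
  have /eqP : (numq q)%:~R * n%:~R = a%:~R * (denq q)%:~R :> rat.
    rewrite -{1}[(numq q)%:~R](@mulfVK _ (denq q)%:~R) ?intr_eq0 ?denq_neq0 // divq_num_den /q.
    by rewrite mulrAC divfK ?intr_eq0.
  by rewrite -!intrM eqr_int => /eqP.
apply/eqP; rewrite eqr_div ?inj ?denq_neq0 // -!intrM e mulrC //.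
Qed.

Lemma Qw_number_field : number_field Qw.
Proof.
split; first exact: Qw_closed.
exists [:: 1; w].
  move=> x; rewrite in_cons mem_seq1 => /orP[] /eqP->; apply/asboolP.
    by exists e1, e1; split=> //; rewrite zemb1 divr1.
  by exists ew, e1; split=> //; rewrite zembw zemb1 divr1.
move=> x /asboolP[z [d [d0 ->]]].
have n0 : int_of_Z (enorm d) != 0.
  apply/eqP => /(congr1 Z_of_int); rewrite int_of_ZK => h; apply: d0; exact: enorm_eq0.
(* Coordinates over Q come from z / d = z conj(d) / N(d). *)
pose u := emul z (econj d).
exists (fun i => (if i is 0%N then (int_of_Z (ere u))%:~R else (int_of_Z (eim u))%:~R) /
  (int_of_Z (enorm d))%:~R).
rewrite /= !big_ord_recl big_ord0 addr0 /= !ratr_frac // mulr1.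
have d1 := zemb_neq0 d0.
have cd0 : iota (econj d) != 0.
  apply: zemb_neq0 => h; apply: d0; apply: enorm_eq0.
  by have := f_equal ere (emul_conj d); rewrite h /=; lia.
have -> : iota z / iota d = iota u / iota (emul d (econj d)).
  by rewrite /u !(zembM hw); field; rewrite d1 cd0.
rewrite emul_conj {1}/zemb /zemb /= mulr0z mul0r addr0 mulrDl.
by rewrite mulrAC.
Qed.

Lemma zemb_integral z : integralOver (intr : int -> F) (iota z).
Proof.
have iw : integralOver (intr : int -> F) w.
  exists ('X^2 + 'X + 1).
    by rewrite -addrA monicE lead_coefDl ?lead_coefXn // size_polyXn -polyC1 size_XaddC.
  by rewrite /root !rmorphD /= map_polyXn map_polyX rmorph1 !hornerE hw; apply/eqP; ring.
rewrite /zemb; apply: integral_add; first exact: integral_id.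
by apply: integral_mul => //; apply: integral_id.
Qed.

Lemma epow_x (z d : eis) x n i : d <> e0 -> x = iota z / iota d -> (i <= n)%N ->
  exists u, iota d ^+ n * x ^+ i = iota u.
Proof.
move=> d0 -> le; have d1 := zemb_neq0 d0.
exists (emul (iter (n - i) (emul d) e1) (iter i (emul z) e1)).
have pw t m : iota (iter m (emul t) e1) = iota t ^+ m.
  by elim: m => [|m IH]; rewrite ?zemb1 //= (zembM hw) IH exprS.
rewrite (zembM hw) !pw -{1}(subnK le) exprD expr_div_n -mulrA; congr (_ * _).
by rewrite mulrCA divff ?mulr1 // expf_neq0.
Qed.

(** O is integrally closed because it is Euclidean. The v with v x^i in O for all i form a nonzero
    ideal stable under multiplication by x; dividing v x by v leaves a remainder in this ideal of
    smaller norm, so by descent some v divides v x, and x lies in O. *)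
Lemma integral_Zadj x : x \in Qw -> integralOver (intr : int -> F) x -> Zadj w x.
Proof.
move=> /asboolP[z [d [d0 ex]]] [p pm /eqP px]; have d1 := zemb_neq0 d0.
pose J v := forall i, exists u, iota v * x ^+ i = iota u.
pose n := (size p).-1.
have xn : x ^+ n = - \sum_(i < n) (p`_i)%:~R * x ^+ i.
  move: px; rewrite horner_coef size_map_poly_id0; last first.
    by rewrite (monicP pm) oner_neq0.
  have sp : size p = n.+1 by rewrite /n prednK // size_poly_gt0 monic_neq0.
  rewrite sp big_ord_recr /= coef_map /= -[p`_n]/(lead_coef p) (monicP pm) mul1r => /eqP.
  rewrite addrC addr_eq0 => /eqP ->; congr (- _).
  by apply: eq_bigr => i _; rewrite coef_map.
have Jd : exists2 v, J v & v <> e0.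
  have [v hv] := epow_x d0 ex (leq0n n); rewrite expr0 mulr1 in hv.
  exists v; last by move=> h; move: hv; rewrite h zemb0 => /eqP;
    rewrite expf_eq0 (negbTE d1) andbF.
  (* The denominator d^n clears the powers up to n; higher powers are lowered by the monic
     equation. *)
  elim/ltn_ind => i IH; case: (leqP i n) => hi; first by rewrite -hv; exact: (epow_x d0 ex hi).
  have -> : x ^+ i = x ^+ (i - n) * x ^+ n by rewrite -exprD subnK // ltnW.
  rewrite xn mulrN mulr_sumr mulrN mulr_sumr.
  have sumO (m : nat) (f : 'I_m -> F) : (forall i, exists u, f i = iota u) -> exists u,
    \sum_i f i = iota u.
    move=> hf; elim: m f hf => [|m IHm] f hf; first by exists e0; rewrite big_ord0 zemb0.
    rewrite big_ord_recl; have [u ->] := hf ord0.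
    have [t ->] := IHm (fun i => f (lift ord0 i)) (fun i => hf _).
    by exists (eadd u t); rewrite zembD.
  have [u ->] : exists u, \sum_(j < n) iota v * (x ^+ (i - n) * ((p`_j)%:~R * x ^+ j)) = iota u.
    apply: sumO => j; have [|u hu] := IH (i - n + j)%N.
      by rewrite -ltn_subRL subKn // ltnW.
    exists (emul (Eis (Z_of_int p`_j) Z0) u).
    rewrite (zembM hw) -hu exprD [iota (Eis _ _)]/zemb /= Z_of_intK mulr0z mul0r addr0; ring.
  by exists (eopp u); rewrite zembN.
have Jx v u : J v -> iota v * x = iota u -> J u.
  by move=> Jv e i; have [t ht] := Jv i.+1; exists t; rewrite -ht exprS mulrA e.
case: Jd => v Jv v0; have [m] : exists m : nat, (enorm v <= Z.of_nat m)%Z.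
  by exists (Z.to_nat (enorm v)); have := @enorm_ge0 v; lia.
elim: m v Jv v0 => [|m IH] v Jv v0 hm.
  by case: v0; apply: enorm_eq0; have := @enorm_ge0 v; lia.
have [u hu] := Jv 1%N; rewrite expr1 in hu.
have [q hq] := eis_euclid u v0.
have [e|ne] := pselect (esub u (emul q v) = e0).
  apply/(Zadj_zemb hw); exists q; apply: (mulfI (zemb_neq0 v0)); rewrite hu.
  by have := f_equal iota e; rewrite zembB (zembM hw) zemb0 => /eqP; rewrite subr_eq0 mulrC
    => /eqP.
apply: (IH _ _ ne); last by lia.
move=> i; have [t ht] := Jx _ _ Jv hu i; have [s hs] := Jv i.
by exists (esub t (emul q s)); rewrite !zembB !(zembM hw) -ht -hs; ring.
Qed.

Lemma ring_of_integers_Qw : ring_of_integers Qw = Zadj w.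
Proof.
apply/seteqP; split=> [x [xQ xi]|x /(Zadj_zemb hw)[z ->]]; first exact: integral_Zadj.
split; last exact: zemb_integral.
by apply/asboolP; exists z, e1; split=> //; rewrite zemb1 divr1.
Qed.

Lemma K0_cong : K w 0 = PSL_cong (Zadj w) (Zadj w).
Proof.
rewrite /K (_ : principal _ _ = Zadj w) //; apply/seteqP; split=> x.
  by case=> y hy <-; rewrite expr0 mul1r.
by move=> hx; exists x; rewrite // expr0 mul1r.
Qed.

End Integers.

(** * The theorem *)

Section Adjoin.
Variables (R : realType) (omega r : R[i]).
Hypotheses (omega_prim : 3.-primitive_root omega) (r_cube : r ^+ 3 = 1 - omega).

Lemma Qadj_char0 : injective (intr : int -> Qadj r).
Proof. by move=> a b /(congr1 val); rewrite !rmorph_int => /intr_inj. Qed.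

Lemma Qadj_omega : (MkQadj (omega_in_Qadj r_cube)) ^+ 2 = - (MkQadj (omega_in_Qadj r_cube)) - 1.
Proof.
apply: val_inj; rewrite rmorphXn rmorphB rmorphN rmorph1 /=.
have w1 : omega - 1 != 0.
  rewrite subr_eq0; apply/eqP => e.
  by have := prim_order_dvd omega_prim 1; rewrite expr1 e eqxx.
apply: (mulfI w1); have w3 := prim_expr_order omega_prim; ring: w3.
Qed.

Lemma Qadj_r : (Qadj_gen r) ^+ 3 = 1 - MkQadj (omega_in_Qadj r_cube).
Proof. by apply: val_inj; rewrite rmorphXn rmorphB rmorph1. Qed.

End Adjoin.

Theorem theorem2 (R : realType) (omega r : R[i])
    (omega_prim : 3.-primitive_root omega) (r_cube : r ^+ 3 = 1 - omega) :
  let E := Qadj r in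
  let rE : E := Qadj_gen r in
  let wE : E := MkQadj (omega_in_Qadj r_cube) in
  exists pi : {multiplicative Gamma -> PSL 3 E},
    (represents (pi_a wE rE) (pi gen_a) /\ represents (pi_b wE rE) (pi gen_b)) /\
    commensurable (range pi) (K wE 0) /\
    arithmetic (range pi) /\
    (range pi `&` K wE 0 = pi @` Gamma0 /\
     has_index (range pi) (range pi `&` K wE 0) 3) /\
    (has_index (K wE 0) (range pi `&` K wE 0) (2 ^ 4 * 3 * 13)%N /\
     (K wE 2 `<=` range pi) /\
     (lcosets (range pi `&` K wE 1) (K wE 2) = coset12 wE @` sl3_sub) /\
     (lcosets (range pi `&` K wE 0) (K wE 1) = coset01 wE @` Uplus)).
Proof.
move=> E rE wE.
have char0 : injective (intr : int -> E) := @Qadj_char0 R r.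
have hw : wE ^+ 2 = - wE - 1 := Qadj_omega omega_prim r_cube.
have hr : rE ^+ 3 = 1 - wE := Qadj_r r_cube.
have [pi [ra rb]] := pi_exists char0 hw hr.
have eI := range_K0 char0 hw hr ra rb.
have ind3 := range_index char0 hw hr ra rb; have ind624 := K0_index char0 hw.
have comm : commensurable (range pi) (K wE 0).
  split; rewrite 1?[K wE 0 `&` _]setIC eI.
    exact: has_index_finite ind3.
  exact: has_index_finite ind624.
have e1 : range pi `&` K wE 1 = Img wE `&` K wE 1.
  rewrite -eI -setIA; congr (_ `&` _).
  by apply/seteqP; split=> [g K1|g []] //; split=> //; apply: (K_sub_K0 char0 hw) K1.
exists pi; split=> //; split=> //; split.
  exists (Qw wE); first exact: Qw_number_field.
  by rewrite /= ring_of_integers_Qw // -K0_cong.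
rewrite eI e1; split.
  by split=> //; apply/seteqP; split=> g; move/(Img_Gamma0 char0 hw hr ra rb).
split; first exact: ind624.
split; first by move=> g /(K2_Img char0 hw); rewrite -eI => -[].
by split; [apply: lcosets12|apply: lcosets01].
Qed.
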